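(* Let $\Lambda$ be an artin algebra and let $n$ be a positive integer. Then $\Lambda$ is left $n$-Nakayama if and only if $\Lambda$ is right $n$-coNakayama.
   Context: An artin algebra is an algebra $\Lambda$ over a commutative artinian ring $R$ that is finitely generated as an $R$-module. All modules are finitely generated. For a module $M$: $\mathrm{rad}^0(M)=M$, $\mathrm{rad}^{i+1}(M)=\mathrm{rad}(\mathrm{rad}^i(M))$; and $\mathrm{soc}^0(M)=0$, with $\mathrm{soc}^{i+1}(M)$ the submodule containing $\mathrm{soc}^i(M)$ such that $\mathrm{soc}^{i+1}(M)/\mathrm{soc}^i(M)=\mathrm{soc}(M/\mathrm{soc}^i(M))$. A module is uniserial if it has a unique composition series (the zero module counts as uniserial). Let $M$ be a nonzero module of length $l$. $M$ is $1$-factor serial, equivalently $1$-cofactor serial, if it is uniserial. For $l\ge n>1$: $M$ is $n$-factor serial if $M/\mathrm{rad}^{l-n}(M)$ is uniserial and $M/\mathrm{rad}^{l-n+1}(M)$ is not uniserial; $M$ is $n$-cofactor serial if $\mathrm{soc}^{l-n}(M)$ is uniserial and $\mathrm{soc}^{l-n+1}(M)$ is not uniserial. $\Lambda$ is left $n$-Nakayama if every indecomposable left $\Lambda$-module is $i$-factor serial for some $1\le i\le n$ and there exists at least one indecomposable $n$-factor serial left $\Lambda$-module. $\Lambda$ is right $n$-coNakayama if every indecomposable right $\Lambda$-module is $i$-cofactor serial for some $1\le i\le n$ and there exists at least one indecomposable $n$-cofactor serial right $\Lambda$-module. *)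

(* Defs.v *)
(* [boolp] turns the propositions defining submodules into
   the boolean membership predicates expected by [submodClosed]. *)
From HB Require Import structures.
From mathcomp Require Import all_boot all_algebra.
From mathcomp Require Import boolp.

Set Implicit Arguments.
Unset Strict Implicit.
Unset Printing Implicit Defensive.

Import GRing.Theory.
Local Open Scope ring_scope.
Local Open Scope quotient_scope.

(* Submodules of M are the elements of the library type [submodClosed M];
   they are compared as sets, with =i. *)

Section SubmoduleConstruction.
Variables (A : pzRingType) (M : lmodType A).

Definition submodule_axiom (P : M -> Prop) : Prop :=
  P 0 /\ forall a u v, P u -> P v -> P (a *: u + v).

Lemma submodule_axiom_closed (P : M -> Prop) :
  submodule_axiom P -> submod_closed (fun x => `[< P x >]).
Proof.
case=> P0 PD; split; first exact/asboolP.
by move=> a u v /asboolP Pu /asboolP Pv; apply/asboolP/PD.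
Qed.

Definition mk_submodule (P : M -> Prop) (hP : submodule_axiom P) :
    submodClosed M :=
  HB.pack (fun x : M => `[< P x >])
    (GRing.isSubmodClosed.Build A M (fun x : M => `[< P x >])
       (submodule_axiom_closed hP)).

Lemma mk_submoduleP (P : M -> Prop) (hP : submodule_axiom P) x :
  reflect (P x) (x \in mk_submodule hP).
Proof. exact: asboolP. Qed.

End SubmoduleConstruction.

Section SubAndQuotient.
Variables (A : pzRingType) (M : lmodType A) (N : submodClosed M).

Definition submodule_zmodClosed : zmodClosed M :=
  HB.pack (fun x : M => x \in N)
    (GRing.isZmodClosed.Build M (fun x : M => x \in N)
       (GRing.submod_closedB (GRing.submodClosedP N))).

(* N regarded as a module in its own right. *)
Definition submodule : Type := {x : M | x \in N}.

HB.instance Definition _ := [isSub of submodule for sval].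
HB.instance Definition _ := [Choice of submodule by <:].
HB.instance Definition _ :=
  [SubChoice_isSubLmodule of submodule by <:].

(* The library's additive quotient M / N, with the induced scaling. *)
Definition quotient_module : Type := Quotient.quot submodule_zmodClosed.

HB.instance Definition _ := GRing.Zmodule.on quotient_module.
HB.instance Definition _ := EqQuotient.on quotient_module.

Definition quotient_scale (a : A) (q : quotient_module) : quotient_module :=
  \pi_quotient_module (a *: repr q).

Lemma eq_piP (x y : M) :
  \pi_quotient_module x = \pi_quotient_module y <-> x - y \in N.
Proof.
rewrite (Quotient.idealrBE submodule_zmodClosed).
by split=> [E|/eqP//]; apply/eqP.
Qed.

Lemma pi_additive : {morph \pi_quotient_module : x y / x + y}.
Proof. by move=> x y; rewrite (Quotient.pi_add submodule_zmodClosed). Qed.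

Lemma quotient_scaleE a x :
  quotient_scale a (\pi_quotient_module x) = \pi_quotient_module (a *: x).
Proof.
apply/eq_piP; rewrite -scalerBr; apply: rpredZ.
by apply/eq_piP; rewrite reprK.
Qed.

Fact quotient_scaleA a b q :
  quotient_scale a (quotient_scale b q) = quotient_scale (a * b) q.
Proof.
rewrite -[q]reprK (quotient_scaleE b (repr q)).
by rewrite (quotient_scaleE a (b *: repr q)) quotient_scaleE scalerA.
Qed.

Fact quotient_scale1 : left_id 1 quotient_scale.
Proof. by move=> q; rewrite -[q]reprK quotient_scaleE scale1r. Qed.

Fact quotient_scaleDr : right_distributive quotient_scale +%R.
Proof.
move=> a p q; rewrite -[p]reprK -[q]reprK -pi_additive !quotient_scaleE.
by rewrite scalerDr pi_additive.
Qed.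

Fact quotient_scaleDl q : {morph quotient_scale^~ q : a b / a + b}.
Proof.
move=> a b; rewrite -[q]reprK !quotient_scaleE.
by rewrite scalerDl pi_additive.
Qed.

HB.instance Definition _ := GRing.Zmodule_isLmodule.Build A quotient_module
  quotient_scaleA quotient_scale1 quotient_scaleDr quotient_scaleDl.

Definition quotient_proj (x : M) : quotient_module := \pi_quotient_module x.

Lemma quotient_proj_is_linear : linear quotient_proj.
Proof.
by move=> a x y; rewrite /quotient_proj pi_additive -quotient_scaleE.
Qed.

HB.instance Definition _ :=
  GRing.isLinear.Build A M quotient_module _ quotient_proj
    quotient_proj_is_linear.

End SubAndQuotient.

Section ModulePredicates.
Variables (A : pzRingType) (M : lmodType A).

Definition nonzero_module : Prop := exists x : M, x != 0.

Definition simple_module : Prop :=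
  nonzero_module /\
  forall N : submodClosed M, N =i pred1 0 \/ N =i predT.

Definition maximal_submodule (N : submodClosed M) : Prop :=
  ~ (N =i predT) /\
  forall K : submodClosed M, {subset N <= K} -> K =i N \/ K =i predT.

End ModulePredicates.

Section RadicalAndSocle.
Variables (A : pzRingType) (M : lmodType A).

Fact rad_axiom : submodule_axiom
  (fun x : M => forall N : submodClosed M, maximal_submodule N -> x \in N).
Proof.
split=> [N _|a u v Pu Pv N maxN]; first exact: rpred0.
by rewrite rpredD ?rpredZ ?Pu ?Pv.
Qed.

(* The intersection of all maximal submodules, M itself if there are none. *)
Definition rad : submodClosed M := mk_submodule rad_axiom.

Fact soc_axiom : submodule_axiom
  (fun x : M => exists2 s : seq M,
     forall y, y \in s ->
       exists2 S : submodClosed M, simple_module (submodule S) & y \in S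
   & x = \sum_(y <- s) y).
Proof.
split=> [|a _ _ [s sP ->] [t tP ->]]; first by exists [::]; rewrite ?big_nil.
exists ([seq a *: y | y <- s] ++ t).
  move=> y; rewrite mem_cat => /orP[/mapP[z /sP[S simS Sz] ->]|/tP//].
  by exists S; rewrite ?rpredZ.
by rewrite big_cat big_map scaler_sumr.
Qed.

(* The sum of all simple submodules. *)
Definition soc : submodClosed M := mk_submodule soc_axiom.

End RadicalAndSocle.

Section Series.
Variables (A : pzRingType) (M : lmodType A).

Fact image_axiom (N : submodClosed M) (K : submodClosed (submodule N)) :
  submodule_axiom (fun x : M => exists2 y : submodule N, y \in K & val y = x).
Proof.
split=> [|a _ _ [y Ky <-] [z Kz <-]].
  by exists 0; rewrite ?rpred0 ?raddf0.
by exists (a *: y + z); rewrite ?rpredD ?rpredZ //= linearP.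
Qed.

(* A submodule of the module N, as a submodule of M. *)
Definition submodule_image (N : submodClosed M)
  (K : submodClosed (submodule N)) : submodClosed M :=
  mk_submodule (@image_axiom N K).

Fact preimage_axiom (N : submodClosed M)
    (K : submodClosed (quotient_module N)) :
  submodule_axiom (fun x : M => quotient_proj N x \in K).
Proof.
split=> [|a u v Ku Kv]; first by rewrite raddf0 rpred0.
by rewrite linearP rpredD ?rpredZ.
Qed.

(* The submodule of M containing N whose quotient by N is K. *)
Definition quotient_preimage (N : submodClosed M)
  (K : submodClosed (quotient_module N)) : submodClosed M :=
  mk_submodule (@preimage_axiom N K).

Fact zero_axiom : submodule_axiom (fun x : M => x = 0).
Proof. by split=> // a _ _ -> ->; rewrite scaler0 addr0. Qed.

Definition zero_submodule : submodClosed M := mk_submodule zero_axiom.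

Fact full_axiom : submodule_axiom (fun _ : M => True).
Proof. by []. Qed.

Definition full_submodule : submodClosed M := mk_submodule full_axiom.

Fixpoint rad_pow (i : nat) : submodClosed M :=
  if i is j.+1 then submodule_image (rad (submodule (rad_pow j)))
  else full_submodule.

Fixpoint soc_pow (i : nat) : submodClosed M :=
  if i is j.+1 then quotient_preimage (soc (quotient_module (soc_pow j)))
  else zero_submodule.

Fact restrict_axiom (K N : submodClosed M) :
  submodule_axiom (fun y : submodule K => val y \in N).
Proof.
split=> [|a u v Nu Nv]; first by rewrite raddf0 rpred0.
by rewrite linearP rpredD ?rpredZ.
Qed.

(* The submodule N :&: K of the module K. *)
Definition restrict_submodule (K N : submodClosed M) :
    submodClosed (submodule K) :=
  mk_submodule (@restrict_axiom K N).

(* 0 = N 0, N 1, ..., N l = M is a composition series; the values of N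
   beyond l are irrelevant. *)
Definition composition_series (l : nat) (N : nat -> submodClosed M) : Prop :=
  [/\ N 0%N =i pred1 0, N l =i predT &
   forall i, (i < l)%N -> {subset N i <= N i.+1} /\
     simple_module (quotient_module (restrict_submodule (N i.+1) (N i)))].

Definition has_length (l : nat) : Prop :=
  exists N, composition_series l N.

Definition uniserial : Prop :=
  exists l N, composition_series l N /\
    forall l' N', composition_series l' N' ->
      l' = l /\ forall i, (i <= l)%N -> N' i =i N i.

Definition finitely_generated : Prop :=
  exists (k : nat) (g : 'I_k -> M),
    forall x, exists c : 'I_k -> A, x = \sum_i c i *: g i.

Definition indecomposable : Prop :=
  nonzero_module M /\
  forall N K : submodClosed M,
    (forall x, x \in N -> x \in K -> x = 0) ->
    (forall x, exists y z, [/\ y \in N, z \in K & x = y + z]) ->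
    N =i pred1 0 \/ K =i pred1 0.

End Series.

Section FactorSerial.
Variables (A : pzRingType) (n : nat) (M : lmodType A).

Definition factor_serial : Prop :=
  nonzero_module M /\
  ((n = 1%N /\ uniserial M) \/
   exists l, [/\ has_length M l, (1 < n <= l)%N,
     uniserial (quotient_module (rad_pow M (l - n))) &
     ~ uniserial (quotient_module (rad_pow M (l - n + 1)))]).

Definition cofactor_serial : Prop :=
  nonzero_module M /\
  ((n = 1%N /\ uniserial M) \/
   exists l, [/\ has_length M l, (1 < n <= l)%N,
     uniserial (submodule (soc_pow M (l - n))) &
     ~ uniserial (submodule (soc_pow M (l - n + 1)))]).

End FactorSerial.

Definition left_Nakayama (n : nat) (A : pzRingType) : Prop :=
  (forall M : lmodType A, finitely_generated M -> indecomposable M ->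
     exists2 i, (1 <= i <= n)%N & factor_serial i M) /\
  exists M : lmodType A,
    [/\ finitely_generated M, indecomposable M & factor_serial n M].

(* Right A-modules are left modules over the opposite ring A^c. *)
Definition right_coNakayama (n : nat) (A : pzRingType) : Prop :=
  (forall M : lmodType A^c, finitely_generated M -> indecomposable M ->
     exists2 i, (1 <= i <= n)%N & cofactor_serial i M) /\
  exists M : lmodType A^c,
    [/\ finitely_generated M, indecomposable M & cofactor_serial n M].

(* Descending chain condition on ideals, i.e. on submodules of R^o. *)
Definition artinian (R : comPzRingType) : Prop :=
  forall I : nat -> submodClosed R^o,
    (forall k, {subset I k.+1 <= I k}) ->
    exists k, forall m, (k <= m)%N -> I m =i I k.

(* The algebra structure is given by its structure morphism into the centre:
   the library's [algType] would exclude the zero algebra. *)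
Definition artin_algebra (R : comPzRingType) (A : pzRingType)
    (phi : {rmorphism R -> A}) : Prop :=
  [/\ artinian R,
      forall r x, phi r * x = x * phi r &
      exists (k : nat) (g : 'I_k -> A),
        forall x, exists c : 'I_k -> R, x = \sum_i phi (c i) * g i].

(* Main.v *)
(* Each of the properties involved depends only on the lattice of submodules,
   and factor serial and cofactor serial are exchanged by reversing the order
   of that lattice.  It therefore suffices to find, for every finitely
   generated module M over Lambda, a finitely generated module over the
   opposite algebra whose lattice of submodules is anti-isomorphic to that of
   M.  This is Hom_R(M, J), with J the injective envelope of R / rad R.

   The module J is obtained without any theory of injective modules.  Call an
   R-module "of cyclic socle type" if Hom_R(S, J) is simple or zero for every
   simple S; then the length of Hom_R(X, J) is at most that of X, and that of J
   at most that of R.  A J of maximal length in this class has no proper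
   extension in the class, which forces it to be a cogenerator for the modules
   of finite length; the two length bounds give K^perp^perp = K for the
   submodules K of Hom_R(X, J). *)
From HB Require Import structures.
From mathcomp Require Import all_boot all_algebra.
From mathcomp Require Import boolp classical_sets functions.
Require Import Defs.

Set Implicit Arguments.
Unset Strict Implicit.
Unset Printing Implicit Defensive.

Import GRing.Theory.
Local Open Scope ring_scope.
Local Open Scope quotient_scope.

(** * Submodules of quotients and of submodules *)

Section Submodules.
Variables (A : pzRingType) (M : lmodType A).
Implicit Types N K Z : submodClosed M.

Lemma submodB N x y : x \in N -> y \in N -> x - y \in N.
Proof. by move=> Nx Ny; rewrite -scaleN1r rpredD ?rpredZ. Qed.

Lemma in_restrict_submodule K N (y : submodule K) :
  (y \in restrict_submodule K N) = (val y \in N).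
Proof. exact: asboolb. Qed.

Lemma in_quotient_preimage N (Q : submodClosed (quotient_module N)) x :
  (x \in quotient_preimage Q) = (quotient_proj N x \in Q).
Proof. exact: asboolb. Qed.

Lemma in_submodule_image N (Q : submodClosed (submodule N)) (y : submodule N) :
  (val y \in submodule_image Q) = (y \in Q).
Proof.
apply/idP/idP => [/mk_submoduleP [z Qz /val_inj <-] //|Qy].
by apply/mk_submoduleP; exists y.
Qed.

Lemma submodule_image_sub N (Q : submodClosed (submodule N)) :
  {subset submodule_image Q <= N}.
Proof. by move=> _ /mk_submoduleP [y _ <-]; apply: valP. Qed.

Lemma quotient_projK N (q : quotient_module N) : quotient_proj N (repr q) = q.
Proof. exact: reprK. Qed.

Lemma quotient_proj_eq N x y :
  quotient_proj N x = quotient_proj N y <-> x - y \in N.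
Proof. exact: eq_piP. Qed.

Lemma quotient_proj_eq0 N x : quotient_proj N x = 0 <-> x \in N.
Proof. by rewrite -(raddf0 (quotient_proj N)) quotient_proj_eq subr0. Qed.

Fact quotient_image_axiom N Z : submodule_axiom
  (fun q : quotient_module N => exists2 x, x \in Z & quotient_proj N x = q).
Proof.
split=> [|a _ _ [x Zx <-] [y Zy <-]]; first by exists 0; rewrite ?rpred0 ?raddf0.
by exists (a *: x + y); rewrite ?rpredD ?rpredZ // linearP.
Qed.

Definition quotient_image N Z := mk_submodule (@quotient_image_axiom N Z).

Lemma in_quotient_image N Z x : {subset N <= Z} ->
  (quotient_proj N x \in quotient_image N Z) = (x \in Z).
Proof.
move=> NZ; apply/idP/idP => [/mk_submoduleP [y Zy /eq_piP/NZ Zyx]|Zx].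
  by rewrite -[x](subKr y); apply: submodB.
by apply/mk_submoduleP; exists x.
Qed.

End Submodules.

(** * Simple quotients, radical and socle in terms of covering pairs of submodules *)

Section Covers.
Variables (A : pzRingType) (M : lmodType A).
Implicit Types N K Z : submodClosed M.

Lemma quotient_proj_restrict_eq0 N K (y : submodule K) :
  quotient_proj (restrict_submodule K N) y = 0 <-> val y \in N.
Proof. by rewrite (@quotient_proj_eq0 _ (submodule K)) in_restrict_submodule. Qed.

(** Only inclusions between submodules of [M] occur here, so an order-reversing bijection of
    lattices simply exchanges the two ends of a covering pair. *)
Definition cover N K : Prop :=
  [/\ {subset N <= K}, exists2 x, x \in K & x \notin N &
   forall Z, {subset N <= Z} -> {subset Z <= K} -> Z =i N \/ Z =i K].

Lemma coverP N K : {subset N <= K} ->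
  simple_module (quotient_module (restrict_submodule K N)) <-> cover N K.
Proof.
move=> NK; set R := restrict_submodule K N.
split=> [[[q q0] simQ]|[_ [x Kx Nx] covNK]]; split=> //.
- exists (val (repr q)); first exact: valP.
  apply: contraNN q0 => /quotient_proj_restrict_eq0.
  by rewrite quotient_projK => ->.
- move=> Z NZ ZK.
  have RZ : {subset R <= restrict_submodule K Z}.
    by move=> y; rewrite !in_restrict_submodule => /NZ.
  have mem y : (quotient_proj R y \in quotient_image R (restrict_submodule K Z))
      = (val y \in Z).
    by rewrite in_quotient_image // in_restrict_submodule.
  case: (simQ (quotient_image R (restrict_submodule K Z))) => E; [left|right] => x.
  + apply/idP/idP => [Zx|/NZ //]; have := mem (Sub x (ZK _ Zx)).
    rewrite /= Zx E inE => /eqP.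
    by move/quotient_proj_restrict_eq0.
  + apply/idP/idP => [/ZK //|Kx]; have := mem (Sub x Kx).
    by rewrite E inE /= => <-.
- exists (quotient_proj R (Sub x Kx)); apply: contraNneq Nx.
  by move/quotient_proj_restrict_eq0.
- move=> Q; have mem (y : submodule K) :
      (val y \in submodule_image (quotient_preimage Q)) = (quotient_proj R y \in Q).
    by rewrite in_submodule_image in_quotient_preimage.
  case: (covNK (submodule_image (quotient_preimage Q))) => [z Nz||E|E].
  + rewrite -[z]/(val (Sub z (NK _ Nz) : submodule K)) mem.
    by rewrite (_ : quotient_proj R _ = 0) ?rpred0 //; apply/quotient_proj_restrict_eq0.
  + exact: submodule_image_sub.
  + left=> q; rewrite -[q]quotient_projK -mem E inE.
    by apply/idP/eqP => /quotient_proj_restrict_eq0.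
  + by right=> q; rewrite -[q]quotient_projK -mem E; apply: valP.
Qed.

Lemma simple_submoduleP N : simple_module (submodule N) <-> 
  (exists2 x, x \in N & x != 0) /\
  forall Z, {subset Z <= N} -> Z =i pred1 0 \/ Z =i N.
Proof.
split=> [[[x x0] sim]|[[x Nx x0] sim]]; split.
- by exists (val x); [apply: valP|].
- move=> Z ZN; case: (sim (restrict_submodule N Z)) => E; [left|right] => z.
    apply/idP/idP => [Zz|]; last by rewrite inE => /eqP ->; rewrite rpred0.
    have := E (Sub z (ZN _ Zz)); rewrite in_restrict_submodule /= Zz !inE.
    by move/esym/eqP/(congr1 val) => /= ->.
  apply/idP/idP => [/ZN //|Nz]; have := E (Sub z Nz).
  by rewrite in_restrict_submodule.
- by exists (Sub x Nx); apply: contraNneq x0 => /(congr1 val) /= ->.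
- move=> Q; case: (sim (submodule_image Q)) => [|E|E]; first exact: submodule_image_sub.
    by left=> y; rewrite -in_submodule_image E !inE.
  by right=> y; rewrite -in_submodule_image E; apply: valP.
Qed.

(** Image and restriction identify the maximal submodules of [N] with the submodules of [M] that [N]
    covers. The radical of [N] thus becomes a meet formed in the lattice of [M]. *)
Lemma rad_submoduleP N x : x \in submodule_image (rad (submodule N)) <->
  x \in N /\ forall Z, cover Z N -> x \in Z.
Proof.
split=> [radx|[Nx radx]].
  have Nx := submodule_image_sub radx; split=> // Z [ZN [y Ny Zy] covZ].
  move: radx; rewrite -[x]/(val (Sub x Nx : submodule N)) in_submodule_image.
  move/mk_submoduleP/(_ (restrict_submodule N Z)).
  rewrite in_restrict_submodule; apply; split.
    by move/(_ (Sub y Ny)); rewrite in_restrict_submodule inE /=; apply/negP.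
  move=> Q ZQ; case: (covZ (submodule_image Q)) => [z Zz||E|E].
  - rewrite -[z]/(val (Sub z (ZN _ Zz) : submodule N)) in_submodule_image.
    by apply: ZQ; rewrite in_restrict_submodule.
  - exact: submodule_image_sub.
  - by left=> z; rewrite -in_submodule_image E in_restrict_submodule.
  - by right=> z; rewrite -in_submodule_image E; apply: valP.
rewrite -[x]/(val (Sub x Nx : submodule N)) in_submodule_image.
apply/mk_submoduleP => Q [Qproper Qmax]; rewrite -in_submodule_image.
apply: radx; split; first exact: submodule_image_sub.
  apply: contrapT => full; apply: Qproper => y; rewrite inE.
  apply: contrapT => Qy; apply: full; exists (val y); first exact: valP.
  by rewrite in_submodule_image; apply/negP.
move=> Z QZ ZN; case: (Qmax (restrict_submodule N Z)) => [y Qy|E|E].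
- by rewrite in_restrict_submodule; apply: QZ; rewrite in_submodule_image.
- left=> z; apply/idP/idP => [Zz|/QZ //]; have := E (Sub z (ZN _ Zz)).
  by rewrite in_restrict_submodule /= Zz -in_submodule_image.
- right=> z; apply/idP/idP => [/ZN //|Nz]; have := E (Sub z Nz).
  by rewrite in_restrict_submodule.
Qed.

End Covers.

Section Socle.
Variables (A : pzRingType) (M : lmodType A).
Implicit Types N Z T : submodClosed M.

(** Simple submodules of the quotient by [N] correspond to the covers of [N]. The sum of these
    covers is given by its upper bounds, which is the order dual of the description of the
    radical. *)
Lemma soc_quotientP N x : x \in quotient_preimage (soc (quotient_module N)) <->
  forall Z, {subset N <= Z} -> (forall T, cover N T -> {subset T <= Z}) -> x \in Z.
Proof.
rewrite in_quotient_preimage; split=> [/mk_submoduleP [s sP Es] Z NZ covZ|].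
  rewrite -(in_quotient_image x NZ) Es; elim: s sP {Es} => [|q s IHs] sP.
    by rewrite big_nil rpred0.
  rewrite big_cons rpredD ?IHs //; last by move=> y sy; apply: sP; rewrite inE sy orbT.
  have [|S simS Sq] := sP q; first by rewrite inE eqxx.
  move: simS => /(@simple_submoduleP _ (quotient_module N)) [[q' Sq' q'0] simS].
  rewrite -(quotient_projK q) in_quotient_image //.
  have NS : {subset N <= quotient_preimage S}.
    move=> y /quotient_proj_eq0; rewrite in_quotient_preimage => ->.
    exact: rpred0.
  apply: (covZ (quotient_preimage S)); last by rewrite in_quotient_preimage quotient_projK.
  split=> //.
    exists (repr q'); first by rewrite in_quotient_preimage quotient_projK.
    apply: contraNN q'0 => /quotient_proj_eq0.
    by rewrite quotient_projK => ->.
  move=> T NT TS; case: (simS (quotient_image N T)) => [q1|E|E].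
  - rewrite -[q1]quotient_projK in_quotient_image // => /TS.
    by rewrite in_quotient_preimage.
  - left=> y; rewrite -(in_quotient_image y NT) E inE.
    by apply/eqP/idP => /quotient_proj_eq0.
  - by right=> y; rewrite -(in_quotient_image y NT) E in_quotient_preimage.
(* Conversely, the preimage of the socle is itself one of the test submodules [Z]: if [T] covers
   [N], the image of [T] is simple, and each of its elements is a sum with one term. *)
move/(_ (quotient_preimage (soc (quotient_module N)))).
rewrite in_quotient_preimage; apply.
  move=> y /quotient_proj_eq0; rewrite in_quotient_preimage => ->.
  exact: rpred0.
move=> T [NT [y Ty Ny] covT] z Tz; rewrite in_quotient_preimage.
apply/mk_submoduleP; exists [:: quotient_proj N z]; last by rewrite big_seq1.
move=> _ /[1!inE] /eqP ->; exists (quotient_image N T); last by rewrite in_quotient_image.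
apply/(@simple_submoduleP _ (quotient_module N)); split.
  exists (quotient_proj N y); first by rewrite in_quotient_image.
  by apply: contraNneq Ny => /quotient_proj_eq0.
move=> Q QT; case: (covT (quotient_preimage Q)) => [t||E|E].
- rewrite in_quotient_preimage => /quotient_proj_eq0 ->.
  exact: rpred0.
- by move=> t; rewrite in_quotient_preimage => /QT; rewrite in_quotient_image.
- left=> q; rewrite -[q]quotient_projK -in_quotient_preimage E inE.
  by apply/idP/eqP => /quotient_proj_eq0.
- by right=> q; rewrite -[q]quotient_projK -in_quotient_preimage E in_quotient_image.
Qed.

End Socle.

(** * Anti-isomorphic submodule lattices *)

Record lattice_duality (A B : pzRingType) (M : lmodType A) (M' : lmodType B)
    (F : submodClosed M -> submodClosed M')
    (G : submodClosed M' -> submodClosed M) : Prop := LatticeDuality {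
  dualF_sub : forall N K : submodClosed M, {subset N <= K} -> {subset F K <= F N};
  dualG_sub : forall N K : submodClosed M', {subset N <= K} -> {subset G K <= G N};
  dualFK : forall N, G (F N) =i N;
  dualGK : forall K, F (G K) =i K }.

Definition lattice_dual (A B : pzRingType) (M : lmodType A) (M' : lmodType B)
  : Prop := exists F G, lattice_duality (M := M) (M' := M') F G.

Lemma lattice_duality_sym (A B : pzRingType) (M : lmodType A) (M' : lmodType B)
    (F : submodClosed M -> submodClosed M') G :
  lattice_duality F G -> lattice_duality G F.
Proof. by case. Qed.

Lemma lattice_dual_sym (A B : pzRingType) (M : lmodType A) (M' : lmodType B) :
  lattice_dual M M' -> lattice_dual M' M.
Proof. by case=> F [G /lattice_duality_sym FG]; exists G, F. Qed.

Lemma composition_seriesP (A : pzRingType) (M : lmodType A) l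
    (N : nat -> submodClosed M) :
  composition_series l N <->
  [/\ N 0%N =i pred1 0, N l =i predT & forall i, (i < l)%N -> cover (N i) (N i.+1)].
Proof.
split=> [[N0 Nl NS]|[N0 Nl NS]]; split=> // i /NS; first by case=> ? /coverP; apply.
by move=> NC; split; [case: NC|apply/coverP => //; case: NC].
Qed.

Section Duality.
Variables (A B : pzRingType) (M : lmodType A) (M' : lmodType B).
Variables (F : submodClosed M -> submodClosed M').
Variables (G : submodClosed M' -> submodClosed M).
Hypothesis FG : lattice_duality F G.
Implicit Types (N K : submodClosed M).

Lemma dualF_eq N K : N =i K -> F N =i F K.
Proof.
by move=> NK x; apply/idP/idP; apply: (dualF_sub FG) => y; rewrite NK.
Qed.

Lemma dualF_subr N K : {subset F N <= F K} -> {subset K <= N}.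
Proof.
by move=> /(dualG_sub FG) FNK x; rewrite -(dualFK FG) => /FNK; rewrite (dualFK FG).
Qed.

Lemma dualF0 N : N =i pred1 0 -> F N =i predT.
Proof.
move=> N0 x; rewrite inE.
have: x \in F (G (full_submodule M')).
  by rewrite (dualGK FG); apply/asboolP.
by apply: (dualF_sub FG) => y; rewrite N0 inE => /eqP ->; exact: rpred0.
Qed.

Lemma dualF1 N : N =i predT -> F N =i pred1 0.
Proof.
move=> N1 x; rewrite inE; apply/idP/eqP => [|->]; last exact: rpred0.
have sub : {subset F N <= F (G (zero_submodule M'))}.
  by apply: (dualF_sub FG) => y _; rewrite N1.
by move=> /sub; rewrite (dualGK FG) => /asboolP.
Qed.

Lemma dualF_cover N K : cover N K -> cover (F K) (F N).
Proof.
move=> [NK [x Kx Nx] covNK]; split; first exact: (dualF_sub FG).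
  apply: contrapT => noy; move/negP: Nx; apply; apply: dualF_subr Kx => y FNy.
  by apply: contrapT => /negP FKy; apply: noy; exists y.
move=> Z KZ ZN; case: (covNK (G Z)) => [y||E|E].
- by rewrite -(dualFK FG); apply: (dualG_sub FG).
- by move=> y /(dualG_sub FG KZ); rewrite (dualFK FG).
- by right=> y; rewrite -(dualGK FG) (dualF_eq E).
- by left=> y; rewrite -(dualGK FG) (dualF_eq E).
Qed.

Lemma dualF_composition_series l (N : nat -> submodClosed M) :
  composition_series l N -> composition_series l (fun i => F (N (l - i)%N)).
Proof.
move=> /composition_seriesP [N0 Nl NC]; apply/composition_seriesP; split.
- by rewrite subn0; apply: dualF1.
- by rewrite subnn; apply: dualF0.
(* Since [i < l], the index [l - i] is the successor of [l - i.+1]; step [i] of the reversed series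
   comes from step [l - i.+1] of the original one. *)
- move=> i il; apply: dualF_cover; rewrite -[X in cover _ (N X)]prednK ?subn_gt0 //.
  by rewrite -subnS; apply: NC; rewrite ltn_subrL (leq_ltn_trans _ il).
Qed.

(** A direct decomposition is a pair with zero meet and full join, and a lattice duality exchanges
    these two conditions. *)
Lemma dualF_indecomposable : indecomposable M -> indecomposable M'.
Proof.
move=> [[x x0] indM]; split.
  apply: contrapT => triv; move/eqP: x0; apply.
  have M'0 (z : M') : z = 0.
    by apply: contrapT => /eqP z0; apply: triv; exists z.
  have: x \in zero_submodule M.
    apply: (@dualF_subr _ (full_submodule M)); last exact/asboolP.
    by move=> y _; rewrite (M'0 y) rpred0.
  by move/asboolP.
move=> N K NK0 NKT.
(* [F] of the intersection of [G N] and [G K] contains both [N] and [K], hence everything, so that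
   intersection is zero. *)
have GNK0 y : y \in G N -> y \in G K -> y = 0.
  move=> GNy GKy; suff: y \in zero_submodule M by move/asboolP.
  have cyc : submodule_axiom (fun z => z \in G N /\ z \in G K).
    split=> [|a u v [? ?] [? ?]]; first by rewrite !rpred0.
    by split; rewrite rpredD ?rpredZ.
  have sub L : {subset mk_submodule cyc <= G L} -> {subset L <= F (mk_submodule cyc)}.
    by move=> /(dualF_sub FG) h z; rewrite -(dualGK FG); apply: h.
  have subN : {subset N <= F (mk_submodule cyc)} by apply: sub => z /asboolP [].
  have subK : {subset K <= F (mk_submodule cyc)} by apply: sub => z /asboolP [].
  suff: {subset mk_submodule cyc <= zero_submodule M}.
    by apply; apply/asboolP.
  apply: dualF_subr => z _; have [u [v [Nu Kv ->]]] := NKT z.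
  by apply: rpredD; [apply: subN|apply: subK].
(* [F] of the sum of [G N] and [G K] lies in both [N] and [K], hence is zero, so that sum is the
   whole module. *)
have GNKT z : exists u v, [/\ u \in G N, v \in G K & z = u + v].
  have sum : submodule_axiom
      (fun z => exists u v, [/\ u \in G N, v \in G K & z = u + v]).
    split=> [|a _ _ [u [v [Nu Kv ->]]] [u' [v' [Nu' Kv' ->]]]].
      by exists 0, 0; rewrite !rpred0 addr0.
    exists (a *: u + u'), (a *: v + v').
    by rewrite !rpredD ?rpredZ // scalerDr addrACA.
  suff: z \in mk_submodule sum by move/asboolP.
  apply: (@dualF_subr _ (full_submodule M)); last exact/asboolP.
  move=> w Fw; suff ->: w = 0 by apply: rpred0.
  apply: NK0; rewrite -(dualGK FG); apply: (dualF_sub FG _ Fw) => u Gu; apply/asboolP.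
    by exists u, 0; rewrite rpred0 addr0.
  by exists 0, u; rewrite rpred0 add0r.
(* The summands change roles: if [G N] is zero then [N] is everything, so [K], which meets [N]
   trivially, is zero. *)
case: (indM _ _ GNK0 GNKT) => G0; [right|left] => z; rewrite inE.
  apply/idP/eqP => [Kz|->]; last exact: rpred0.
  by apply: NK0 => //; rewrite -(dualGK FG) dualF0.
apply/idP/eqP => [Nz|->]; last exact: rpred0.
by apply: NK0 => //; rewrite -(dualGK FG) dualF0.
Qed.

End Duality.

Lemma lattice_dual_indecomposable (A B : pzRingType) (M : lmodType A)
    (M' : lmodType B) :
  lattice_dual M M' -> indecomposable M <-> indecomposable M'.
Proof.
case=> F [G FG]; split; first exact: dualF_indecomposable FG.
exact: (dualF_indecomposable (lattice_duality_sym FG)).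
Qed.

Lemma lattice_dual_has_length (A B : pzRingType) (M : lmodType A)
    (M' : lmodType B) l :
  lattice_dual M M' -> has_length M l -> has_length M' l.
Proof.
by case=> F [G FG] [N /(dualF_composition_series FG) NS]; eexists; exact: NS.
Qed.

Lemma lattice_dual_uniserial (A B : pzRingType) (M : lmodType A)
    (M' : lmodType B) :
  lattice_dual M M' -> uniserial M -> uniserial M'.
Proof.
case=> F [G FG] [l [N [NS uniN]]]; exists l, (fun i => F (N (l - i)%N)).
split=> [|l' N']; first exact: (dualF_composition_series FG).
move=> /(dualF_composition_series (lattice_duality_sym FG)) /uniN [El EN].
split=> // i il x; have := EN (l - i)%N (leq_subr _ _).
by rewrite El subKn // => E; rewrite -(dualF_eq FG E) (dualGK FG).
Qed.

(** * Radical and socle series under a lattice duality *)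

Section FactorDuality.
Variables (A B : pzRingType) (M : lmodType A) (M' : lmodType B).
Variables (F : submodClosed M -> submodClosed M').
Variables (G : submodClosed M' -> submodClosed M).
Hypothesis FG : lattice_duality F G.
Let GF := lattice_duality_sym FG.

(** By induction: the next radical is the meet of the submodules covered by the present one, and [F]
    turns it into the join of the covers of the present socle term. *)
Lemma dualF_rad_pow i : F (rad_pow M i) =i soc_pow M' i.
Proof.
elim: i => [|i IHi] x.
  rewrite (dualF1 FG) => [|y]; last exact/asboolP.
  by rewrite inE; apply/eqP/asboolP.
set N := rad_pow M i in IHi *; set N' := soc_pow M' i in IHi *.
have GN : G N' =i N by move=> y; rewrite -(dualF_eq GF IHi) (dualFK FG).
apply/idP/idP.
  move=> Fx; apply/(@soc_quotientP _ _ N') => Z N'Z covZ; rewrite -(dualGK FG).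
  apply: (dualF_sub FG _ Fx) => y GZy; apply/(@rad_submoduleP _ _ N); split.
    by rewrite -GN; apply: (dualG_sub FG _ GZy).
  move=> Z0 /(dualF_cover FG) covFZ0.
  (* [F N] and [N'] are known to agree only as sets of elements, so the covering relation is
     transferred by hand. *)
  have /covZ sub : cover N' (F Z0).
    have [? [w ? Nw] cov] := covFZ0; split.
    - by move=> y'; rewrite -IHi => ?; auto.
    - by exists w => //; rewrite -IHi.
    - move=> Z1 NZ1 Z1F; case: (cov Z1) => // [z|E|E].
      + by rewrite IHi; apply: NZ1.
      + by left=> z; rewrite -IHi.
      + by right.
  by rewrite -(dualFK FG); apply: (dualG_sub FG _ GZy).
move=> /(@soc_quotientP _ _ N'); apply.
  move=> y; rewrite -IHi; apply: (dualF_sub FG); exact: submodule_image_sub.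
move=> T /(dualF_cover GF) covT y Ty.
have Fy : y \in F (G T) by rewrite (dualGK FG).
apply: (dualF_sub FG _ Fy) => z /(@rad_submoduleP _ _ N) [_]; apply.
have [GTN [w Nw Tw] cov] := covT; split.
- by move=> u /GTN; rewrite GN.
- by exists w; rewrite -?GN.
- move=> Z1 TZ1 Z1N; case: (cov Z1) => // [u /Z1N|E|E]; first by rewrite GN.
    by left.
  by right=> u; rewrite E GN.
Qed.

(** Submodules of the quotient by [K] are the submodules of [M] above [K]; [F] carries them onto the
    submodules of [M'] below [K']. *)
Lemma dual_quotient_submodule (K : submodClosed M) (K' : submodClosed M') :
  F K =i K' -> lattice_dual (quotient_module K) (submodule K').
Proof.
move=> FK.
pose F' (Z : submodClosed (quotient_module K)) : submodClosed (submodule K') :=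
  restrict_submodule K' (F (quotient_preimage Z)).
pose G' (W : submodClosed (submodule K')) : submodClosed (quotient_module K) :=
  quotient_image K (G (submodule_image W)).
have KG (W : submodClosed (submodule K')) : {subset K <= G (submodule_image W)}.
  move=> y; rewrite -(dualFK FG); apply: (dualG_sub FG) => z.
  by move/submodule_image_sub; rewrite FK.
have Kpre (Z : submodClosed (quotient_module K)) : {subset K <= quotient_preimage Z}.
  by move=> y /quotient_proj_eq0; rewrite in_quotient_preimage => ->; apply: rpred0.
have imF Z : submodule_image (F' Z) =i F (quotient_preimage Z).
  move=> y; apply/idP/idP => [/asboolP [z]|Fy].
    by rewrite in_restrict_submodule => Fz <-.
  have K'y : y \in K' by rewrite -FK; apply: (dualF_sub FG (Kpre Z)).
  rewrite -[y]/(val (Sub y K'y : submodule K')) in_submodule_image.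
  by rewrite in_restrict_submodule.
have preG W : quotient_preimage (G' W) =i G (submodule_image W).
  by move=> y; rewrite in_quotient_preimage in_quotient_image.
exists F', G'; split.
- move=> N L NL y; rewrite !in_restrict_submodule; apply: (dualF_sub FG) => z.
  by rewrite !in_quotient_preimage; apply: NL.
- move=> N L NL q; rewrite -[q]quotient_projK !in_quotient_image //.
  apply: (dualG_sub FG) => _ /asboolP [y Ny <-].
  by rewrite in_submodule_image; apply: NL.
- move=> N q; rewrite -[q]quotient_projK in_quotient_image //.
  by rewrite (dualF_eq GF (imF N)) (dualFK FG) in_quotient_preimage.
- move=> W y; rewrite in_restrict_submodule (dualF_eq FG (preG W)) (dualGK FG).
  by rewrite in_submodule_image.
Qed.

End FactorDuality.

Lemma nonzero_moduleP (A : pzRingType) (M : lmodType A) :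
  nonzero_module M <-> ~ zero_submodule M =i predT.
Proof.
split=> [[x x0] /(_ x)|zT].
  by rewrite inE => /asboolP; apply/eqP.
apply: contrapT => triv; apply: zT => x; apply/asboolP.
by apply: contrapT => /eqP x0; apply: triv; exists x.
Qed.

Lemma lattice_dual_nonzero (A B : pzRingType) (M : lmodType A)
    (M' : lmodType B) :
  lattice_dual M M' -> nonzero_module M -> nonzero_module M'.
Proof.
case=> F [G FG] /nonzero_moduleP zT; apply/nonzero_moduleP => zT'; apply: zT => x.
have M'0 (y : M') : y = 0 by apply/asboolP/(zT' y).
apply: (@dualF_subr _ _ _ _ _ _ FG _ (full_submodule M)) => [y _|]; last exact/asboolP.
by rewrite (M'0 y) rpred0.
Qed.

Lemma lattice_dual_serial (A B : pzRingType) (M : lmodType A)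
    (M' : lmodType B) n :
  lattice_dual M M' -> factor_serial n M <-> cofactor_serial n M'.
Proof.
move=> MM'; have M'M := lattice_dual_sym MM'; case: (MM') => F [G FG].
have QS i : lattice_dual (quotient_module (rad_pow M i)) (submodule (soc_pow M' i)).
  exact: (dual_quotient_submodule FG (dualF_rad_pow FG i)).
have SQ i := lattice_dual_sym (QS i).
split=> [[nz H]|[nz H]]; (split; first exact: lattice_dual_nonzero nz).
  case: H => [[n1 uni]|[l [lenM nl uni nuni]]].
    by left; split=> //; apply: lattice_dual_uniserial uni.
  right; exists l; split=> //; first exact: lattice_dual_has_length lenM.
    exact: lattice_dual_uniserial uni.
  by move/(lattice_dual_uniserial (SQ _)).
case: H => [[n1 uni]|[l [lenM nl uni nuni]]].
  by left; split=> //; apply: lattice_dual_uniserial uni.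
right; exists l; split=> //; first exact: lattice_dual_has_length lenM.
  exact: lattice_dual_uniserial uni.
by move/(lattice_dual_uniserial (QS _)).
Qed.

(** * Length *)

Section Length.
Variables (R : pzRingType) (M : lmodType R).
Implicit Types N K L : submodClosed M.

(* [K / N] is simple or zero, in an elementwise form that passes to
   intersections, images, preimages and annihilators. *)
Definition simple_or_zero_step N K : Prop := {subset N <= K} /\
  forall u v, u \in K -> u \notin N -> v \in K -> exists r, v - r *: u \in N.

(** An upper bound for the length of [N] rather than its value, because a step of the chain may be
    trivial. *)
Fixpoint length_le k N : Prop :=
  if k is j.+1 then exists2 N', simple_or_zero_step N' N & length_le j N'
  else forall x, x \in N -> x = 0.

Fact meet_axiom N K : submodule_axiom (fun x => x \in N /\ x \in K).
Proof.
split=> [|a u v [? ?] [? ?]]; first by rewrite !rpred0.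
by rewrite !rpredD ?rpredZ.
Qed.

Definition meet_submodule N K := mk_submodule (meet_axiom N K).

Lemma in_meet N K x : (x \in meet_submodule N K) = (x \in N) && (x \in K).
Proof. by apply/asboolP/andP. Qed.

Lemma step_meet N K L : simple_or_zero_step N L -> {subset K <= L} ->
  simple_or_zero_step (meet_submodule K N) K.
Proof.
move=> [NL simNL] KL; split=> [x|u v Ku]; first by rewrite in_meet => /andP [].
rewrite in_meet Ku => Nu Kv; have [r Nr] := simNL u v (KL _ Ku) Nu (KL _ Kv).
by exists r; rewrite in_meet Nr andbT submodB ?rpredZ.
Qed.

Lemma length_le_sub k N K : {subset K <= N} -> length_le k N -> length_le k K.
Proof.
elim: k N K => [|k IHk] N K KN /=; first by move=> N0 x /KN /N0.
move=> [N' stepN lenN]; exists (meet_submodule K N'); first exact: step_meet KN.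
by apply: IHk lenN => x; rewrite in_meet => /andP [].
Qed.

Lemma length_leW j k N : (j <= k)%N -> length_le j N -> length_le k N.
Proof.
move=> /subnK <-; elim: (k - j)%N => //= m IHm /IHm lenN; exists N => //.
by split=> // u v Nu; rewrite Nu.
Qed.

(** Induction along the chain of [N] with first term [L]: either [K] lies in [L], or [K] is a single
    step above its intersection with [L], which is proper in [L]. *)
Lemma length_le_proper k N K x : {subset K <= N} -> x \in N -> x \notin K ->
  length_le k N -> exists2 j, k = j.+1 & length_le j K.
Proof.
elim: k N K x => [|k IHk] N K x KN Nx Kx /=.
  by move=> N0; move: Kx; rewrite (N0 x Nx) rpred0.
move=> [L stepL lenL]; exists k => //; case: (stepL) => LN simL.
have [KL|] := EM {subset K <= L}.
  have [LK|] := EM {subset L <= K}; first exact: length_le_sub lenL.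
  move=> /existsNP [y /not_implyP [Ly /negP Ky]].
  by have [j -> lenK] := IHk _ _ _ KL Ly Ky lenL; apply: length_leW lenK.
move=> /existsNP [u /not_implyP [Ku /negP Lu]].
(* [K] cannot contain [L]: as [u] is in [K] and outside [L], simplicity of [N / L] would put [x]
   into [K]. *)
have [LK|] := EM {subset L <= K}.
  have [r /LK Kr] := simL u x (KN _ Ku) Lu Nx; case/negP: Kx.
  by rewrite -[x](subrK (r *: u)) rpredD ?rpredZ.
move=> /existsNP [y /not_implyP [Ly /negP Ky]].
have KLL : {subset meet_submodule K L <= L}.
  by move=> z; rewrite in_meet => /andP [].
have KLy : y \notin meet_submodule K L by rewrite in_meet negb_and Ky.
have [j -> lenKL] := IHk _ _ _ KLL Ly KLy lenL.
by exists (meet_submodule K L) => //; apply: step_meet stepL KN.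
Qed.

(** Without a maximal member, the strict growth of lengths yields members of [P] exceeding every
    given length, against the bound on [M]. *)
Lemma exists_maximal_submodule k N0 (P : submodClosed M -> Prop) :
  length_le k (full_submodule M) -> P N0 ->
  exists2 N, P N & forall K, P K -> {subset N <= K} -> {subset K <= N}.
Proof.
move=> lenM PN0; apply: contrapT => nomax.
have up N : P N -> exists2 K, P K & exists2 x, {subset N <= K} & x \in K /\ x \notin N.
  move=> PN; apply: contrapT => noK; apply: nomax; exists N => // K PK NK x Kx.
  by apply: contrapT => /negP Nx; apply: noK; exists K => //; exists x.
suff [N _ []] : exists2 N, P N & ~ length_le k N.
  by apply: length_le_sub lenM => x _; apply/asboolP.
elim: {lenM} k => [|k [N PN lenN]].
  have [K PK [x NK [Kx Nx]]] := up _ PN0; exists K => // /(length_le_proper NK Kx Nx).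
  by case.
have [K PK [x NK [Kx Nx]]] := up _ PN; exists K => // /(length_le_proper NK Kx Nx).
by move=> [_ [<-]].
Qed.

Lemma length_le_finitely_generated k N : length_le k N ->
  exists (n : nat) (g : 'I_n -> M),
    forall x, x \in N -> exists c : 'I_n -> R, x = \sum_i c i *: g i.
Proof.
elim: k N => [|k IHk] N /=.
  move=> N0; exists 0%N, (fun _ => 0) => x /N0 ->.
  by exists (fun _ => 0); rewrite big_ord0.
move=> [N' [N'N simN'] /IHk [n [g gN']]].
have [NN'|] := EM {subset N <= N'}; first by exists n, g => x /NN' /gN'.
move=> /existsNP [u /not_implyP [Nu /negP N'u]].
exists n.+1, (fun i => if unlift ord0 i is Some j then g j else u) => x Nx.
have [r /gN' [c Ec]] := simN' u x Nu N'u Nx.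
exists (fun i => if unlift ord0 i is Some j then c j else r).
rewrite big_ord_recl unlift_none -[LHS](subrK (r *: u)) Ec addrC.
by congr (_ + _); apply: eq_bigr => i _; rewrite liftK.
Qed.

End Length.

(** * Length bounds for images and preimages under linear maps *)

Section LengthMorphism.
Variables (R : pzRingType) (U V : lmodType R) (f : U -> V).
Hypothesis f_linear : linear f.
Implicit Types (N : submodClosed U) (B : submodClosed V).

Lemma linear_fun0 : f 0 = 0.
Proof.
by apply: (addrI (f 0)); rewrite -{1}[f 0]scale1r -f_linear scale1r !addr0.
Qed.

Lemma linear_funB r x y : f (x - r *: y) = f x - r *: f y.
Proof. by rewrite [x - _]addrC [f x - _]addrC -!scaleNr f_linear. Qed.

(** The submodule [B + f(N)]. It is the image of [N] when [B] is zero, and [B + R x] when [f]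
    multiplies [x] by scalars and [N] is [R]. *)
Fact join_image_axiom B N :
  submodule_axiom (fun x => exists2 u, u \in N & x - f u \in B).
Proof.
split=> [|a x y [u Nu Bx] [v Nv By]].
  by exists 0; rewrite ?linear_fun0 ?subr0 rpred0.
exists (a *: u + v); first by rewrite rpredD ?rpredZ.
by rewrite f_linear opprD addrACA -scalerBr rpredD ?rpredZ.
Qed.

Definition join_image B N := mk_submodule (join_image_axiom B N).

Lemma step_join_image B N K : simple_or_zero_step N K ->
  simple_or_zero_step (join_image B N) (join_image B K).
Proof.
move=> [NK simN]; split=> [x /asboolP [u Nu Bx]|x y /asboolP [u Ku Bx]].
  by apply/asboolP; exists u; auto.
move=> Nx /asboolP [v Kv By].
have [|r Nr] := simN u v Ku _ Kv.
  by apply: contraNN Nx => Nu; apply/asboolP; exists u.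
exists r; apply/asboolP; exists (v - r *: u) => //.
have -> : y - r *: x - f (v - r *: u) = (y - f v) - r *: (x - f u).
  by rewrite linear_funB scalerBr !opprD !opprK addrACA.
by rewrite submodB ?rpredZ.
Qed.

Lemma length_le_join_image j k B N : length_le j B -> length_le k N ->
  length_le (k + j)%N (join_image B N).
Proof.
move=> lenB; elim: k N => [|k IHk] N /=.
  move=> N0; apply: length_le_sub lenB => x /asboolP [u /N0 ->].
  by rewrite linear_fun0 subr0.
move=> [N' stepN /IHk lenN']; exists (join_image B N') => //.
exact: step_join_image.
Qed.

(** The part of [N] that [f] maps into [B]; for [B] zero it is the kernel of [f] on [N]. *)
Fact preimage_in_axiom N B : submodule_axiom (fun x => x \in N /\ f x \in B).
Proof.
split=> [|a x y [? ?] [? ?]]; first by rewrite linear_fun0 !rpred0.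
by rewrite f_linear !rpredD ?rpredZ.
Qed.

Definition preimage_in N B := mk_submodule (preimage_in_axiom N B).

Lemma length_le_preimage_in j k N B :
  length_le j (preimage_in N (zero_submodule V)) -> length_le k B ->
  length_le (k + j)%N (preimage_in N B).
Proof.
move=> len0; elim: k B => [|k IHk] B /=.
  move=> B0; apply: length_le_sub len0 => x /asboolP [Nx /B0 fx0].
  by apply/asboolP; split=> //; apply/asboolP.
move=> [B' [B'B simB] /IHk lenB']; exists (preimage_in N B') => //.
split=> [x /asboolP [Nx /B'B Bx]|x y /asboolP [Nx Bx] B'x /asboolP [Ny By]].
  by apply/asboolP.
have [|r B'r] := simB (f x) (f y) Bx _ By.
  by apply: contraNN B'x => B'x; apply/asboolP.
exists r; apply/asboolP; split; first by rewrite submodB ?rpredZ.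
by rewrite linear_funB.
Qed.

End LengthMorphism.

Lemma linear_scaler (R : pzRingType) (M : lmodType R) (x : M) :
  linear (fun r : R^o => (r : R) *: x).
Proof. by move=> a r s; rewrite scalerDl scalerA. Qed.

(** Generators are added one at a time, each cyclic submodule contributing at most the length [k] of
    [R]. *)
Lemma finitely_generated_length_le (R : pzRingType) (M : lmodType R) k :
  length_le k (full_submodule R^o) -> finitely_generated M ->
  exists m, length_le m (full_submodule M).
Proof.
move=> lenR [n [g gM]].
suff [m [N lenN NM]] : exists m, exists2 N, length_le m N &
    forall c : 'I_n -> R, \sum_i c i *: g i \in N.
  exists m; apply: length_le_sub lenN => x _.
  by have [c ->] := gM x; apply: NM.
elim: n g {gM} => [|n IHn] g.
  exists 0%N, (zero_submodule M) => [x /asboolP //|c].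
  by rewrite big_ord0 rpred0.
have [m [N lenN NM]] := IHn (fun i => g (lift ord0 i)).
exists (k + m)%N, (join_image (linear_scaler (g ord0)) N (full_submodule R^o)).
  exact: length_le_join_image.
move=> c; apply/asboolP; exists (c ord0); first exact/asboolP.
by rewrite big_ord_recl addrC addKr; apply: (NM (fun i => c (lift ord0 i))).
Qed.

(** * Commutative artinian rings have finite length *)

(** Zorn's lemma: the union of a nonempty chain of submodules of [N] avoiding [x] is again such a
    submodule, and the zero submodule bounds the empty chain. *)
Lemma exists_submodule_avoiding (R : pzRingType) (M : lmodType R)
    (N : submodClosed M) (x : M) : x != 0 ->
  exists2 H : submodClosed M, {subset H <= N} /\ x \notin H &
    forall K : submodClosed M, {subset K <= N} -> x \notin K ->
      {subset H <= K} -> {subset K <= H}.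
Proof.
move=> x0; pose T := {H : submodClosed M | {subset H <= N} /\ x \notin H}.
pose le (H K : T) := `[< {subset sval H <= sval K} >].
have N0 : {subset zero_submodule M <= N} /\ x \notin zero_submodule M.
  split=> [y /asboolP ->|]; first exact: rpred0.
  by apply: contraNN x0 => /asboolP ->.
pose sub (H : submodClosed M) (PH : {subset H <= N} /\ x \notin H) : T := exist _ H PH.
have le_refl H : le H H by apply/asboolP.
have le_trans K H L : le K H -> le H L -> le K L.
  by move=> /asboolP KH /asboolP HL; apply/asboolP => y /KH /HL.
have [|[H [HN Hx]] maxH] := ZL_preorder (sub _ N0) le_refl le_trans.
  move=> C totC; have [[H0 CH0]|] := EM (exists H0, C H0); last first.
    by move=> noC; exists (sub _ N0) => H CH; case: noC; exists H.
  have union : submodule_axiom (fun y => exists2 H : T, C H & y \in sval H).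
    split=> [|a y z [H CH Hy] [K CK Kz]]; first by exists H0; rewrite ?rpred0.
    case: (totC _ _ CH CK) => /asboolP HK.
      by exists K => //; rewrite rpredD ?rpredZ // HK.
    by exists H => //; rewrite rpredD ?rpredZ // HK.
  have unionP : {subset mk_submodule union <= N} /\ x \notin mk_submodule union.
    split=> [y /asboolP [[H [HN Hx]] /= _ /HN] //|].
    by apply/negP => /asboolP [[H [HN /negP Hx]] /= _].
  by exists (sub _ unionP) => H CH; apply/asboolP => y Hy; apply/asboolP; exists H.
exists H => // K KN Kx HK.
by apply/asboolP; apply: (maxH (sub K (conj KN Kx))); apply/asboolP.
Qed.

(* If some ideal had infinite length, a minimal such ideal I would satisfy
   r I = I or r I = 0 for each r, because I is an extension of r I by the kernel
   of r.  So R / Ann I would be a field and I a vector space over it, whose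
   hyperplanes have finite length by minimality. *)
Section Akizuki.
Variable R : comPzRingType.
Hypothesis artR : artinian R.
Implicit Types (I K : submodClosed R^o).

Let finite_length I := exists k, length_le k I.

(** If no member were minimal, a choice of strictly smaller members could be iterated into a
    descending chain that never stabilizes. *)
Lemma artinian_minimal (P : submodClosed R^o -> Prop) I0 : P I0 ->
  exists2 I, P I & forall K, P K -> {subset K <= I} -> {subset I <= K}.
Proof.
move=> PI0; apply: contrapT => nomin.
have /choice [f fP] (s : {I | P I}) : exists t : {I | P I},
    {subset sval t <= sval s} /\ ~ {subset sval s <= sval t}.
  case: s => I PI; apply: contrapT => noK; apply: nomin; exists I => // K PK KI.
  by apply: contrapT => IK; apply: noK; exists (exist _ K PK).
pose s n := iter n f (exist _ I0 PI0).
have [k sk] := artR (I := fun n => sval (s n)) (fun n => proj1 (fP (s n))).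
by case: (fP (s k)) => _; apply=> x; rewrite -(sk k.+1).
Qed.

Lemma linear_mulr (r : R) : linear (fun x : R^o => (r * x : R^o)).
Proof. by move=> a x y; rewrite mulrDr /GRing.scale /= !mulrA [r * a]mulrC. Qed.

Section MinimalIdeal.
Variable I : submodClosed R^o.
Hypothesis I_infinite : ~ finite_length I.
Hypothesis I_minimal : forall K, ~ finite_length K ->
  {subset K <= I} -> {subset I <= K}.

Lemma minimal_infinite_mul (r : R) :
  (forall x, x \in I -> r * x = 0) \/
  (forall x, x \in I -> exists2 y, y \in I & x = r * y).
Proof.
apply: contrapT => /not_orP [kerI imI].
pose rI := join_image (linear_mulr r) (zero_submodule R^o) I.
pose ker := preimage_in (linear_mulr r) I (zero_submodule R^o).
have [j lenrI] : finite_length rI.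
  apply: contrapT => /I_minimal sub; apply: imI => x Ix.
  have /sub/(_ x Ix)/asboolP [y Iy /asboolP/eqP] : {subset rI <= I}.
    move=> y /asboolP [z Iz /asboolP/eqP]; rewrite subr_eq0 => /eqP ->.
    exact: (@rpredZ _ _ I).
  by rewrite subr_eq0 => /eqP; exists y.
have [k lenker] : finite_length ker.
  apply: contrapT => /I_minimal sub; apply: kerI => x Ix.
  have /sub/(_ x Ix)/asboolP [_ /asboolP //] : {subset ker <= I}.
  by move=> y /asboolP [].
apply: I_infinite; exists (j + k)%N.
apply: length_le_sub (length_le_preimage_in lenker lenrI) => x Ix.
apply/asboolP; split=> //; apply/asboolP; exists x => //.
by rewrite subrr; apply/asboolP.
Qed.

(** Here [r I = I]. The chain of ideals generated by the powers of [r] stabilizes, giving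
    [r ^+ k = t * r ^+ k.+1]; every element of [I] is a multiple of [r ^+ k], so [t] inverts [r] on
    [I]. *)
Lemma minimal_infinite_inv (r : R) x : x \in I -> r * x != 0 ->
  exists t, forall y, y \in I -> y = t * (r * y).
Proof.
move=> Ix rx0; case: (minimal_infinite_mul r) => [rI0|rI].
  by rewrite rI0 ?eqxx in rx0.
pose J n := join_image (linear_scaler (r ^+ n : R^o)) (zero_submodule R^o)
  (full_submodule R^o).
have JP n y : y \in J n <-> exists s : R, y = s * r ^+ n.
  split=> [/asboolP [s _ /asboolP/eqP]|[s ->]].
    by rewrite subr_eq0 => /eqP ->; exists s.
  by apply/asboolP; exists s; [|rewrite subrr]; apply/asboolP.
have [|k Jk] := artR (I := J).
  by move=> n y /JP [s ->]; apply/JP; exists (s * r); rewrite exprS mulrA.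
have /JP [t Et] : r ^+ k \in J k.+1.
  by rewrite Jk //; apply/JP; exists 1; rewrite mul1r.
have rnI n y : y \in I -> exists2 z, z \in I & y = r ^+ n * z.
  elim: n y => [|n IHn] y Iy; first by exists y; rewrite // expr0 mul1r.
  have [z /IHn [w Iw ->] ->] := rI y Iy.
  by exists w => //; rewrite exprS mulrA.
exists t => y /(rnI k) [z _ ->].
by rewrite [r * (_ * _)]mulrA -exprS mulrA -Et.
Qed.

Lemma minimal_infinite_false : False.
Proof.
have [x Ix x0] : exists2 x, x \in I & x != 0.
  apply: contrapT => nox; apply: I_infinite; exists 0%N => x Ix.
  by apply: contrapT => /eqP x0; apply: nox; exists x.
have [H [HI Hx] maxH] := exists_submodule_avoiding I x0.
(* [H] plays the part of a hyperplane: by its maximality, [H + R u] contains [x] as soon as [u] is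
   outside [H]. *)
have span u : u \in I -> u \notin H -> exists c : R, x - c *: u \in H.
  move=> Iu Hu; apply: contrapT => noc.
  pose K := join_image (linear_scaler u) H (full_submodule R^o).
  have KP y : y \in K <-> exists c : R, y - c *: u \in H.
    split=> [/asboolP [c _ ?]|[c ?]]; first by exists c.
    by apply/asboolP; exists c => //; apply/asboolP.
  move/negP: Hu; apply; apply: (maxH K).
  - move=> y /KP [c /HI Iy]; rewrite -[y](subrK (c *: u)).
    by apply: rpredD; rewrite // rpredZ.
  - by apply/negP => /KP.
  - by move=> y Hy; apply/KP; exists 0; rewrite scale0r subr0.
  - by apply/KP; exists 1; rewrite scale1r subrr rpred0.
have [k lenH] : finite_length H.
  by apply: contrapT => /I_minimal /(_ HI) /(_ x Ix); apply/negP.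
apply: I_infinite; exists k.+1; exists H => //; split=> // u v Iu Hu Iv.
have [Hv|Hv] := boolP (v \in H); first by exists 0; rewrite scale0r subr0.
have [c Hc] := span u Iu Hu; have [d Hd] := span v Iv Hv.
have dv0 : d * v != 0.
  by apply: contraNneq Hx => dv0; move: Hd; rewrite /GRing.scale /= dv0 subr0.
have [t tE] := minimal_infinite_inv Iv dv0.
(* Both [d *: v] and [c *: u] are congruent to [x] modulo [H], and [t] inverts [d] on [I]; hence [v]
   is congruent to [(t * c) *: u]. *)
exists (t * c); rewrite {1}(tE v Iv).
have -> : t * (d * v) - (t * c) *: u = t *: ((d *: v - x) + (x - c *: u)).
  by rewrite addrA subrK scalerBr [t *: (c *: u)]scalerA.
by rewrite rpredZ // -[d *: v - x]opprB addrC submodB.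
Qed.

End MinimalIdeal.

Lemma artinian_length_le : exists k, length_le k (full_submodule R^o).
Proof.
apply: contrapT => infR.
have [I infI minI] := artinian_minimal (P := fun I => ~ finite_length I) infR.
exact: minimal_infinite_false infI minI.
Qed.

End Akizuki.

(** * A minimal injective cogenerator *)

Lemma in_full_submodule (R : pzRingType) (M : lmodType R) (x : M) :
  x \in full_submodule M.
Proof. exact/asboolP. Qed.

(** Expressed by a step so that inverses modulo [P] can be read off directly; the condition on [1]
    excludes the zero quotient. *)
Definition maximal_ideal (R : comPzRingType) (P : submodClosed R^o) : Prop :=
  (1 : R) \notin P /\ simple_or_zero_step P (full_submodule R^o).

(* The submodule of [J] annihilated by a maximal ideal is simple or zero. *)
Definition cyclic_socle_type (R : comPzRingType) (J : lmodType R) : Prop :=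
  forall P : submodClosed R^o, maximal_ideal P -> forall x y : J, x != 0 ->
    (forall p : R, p \in P -> p *: x = 0) ->
    (forall p : R, p \in P -> p *: y = 0) -> exists r, y = r *: x.

(** * Annihilators for a bilinear pairing with values in [J] *)

Section Annihilator.
Variables (R : comPzRingType) (U V J : lmodType R) (b : U -> V -> J).
Hypothesis b_linear : forall u, linear (b u).
Implicit Types N K : submodClosed U.

Fact annihilator_axiom N : submodule_axiom (fun v => forall u, u \in N -> b u v = 0).
Proof.
split=> [u _|a v w Nv Nw u Nu]; first exact: linear_fun0.
by rewrite b_linear Nv ?Nw // scaler0 addr0.
Qed.

Definition annihilator N := mk_submodule (annihilator_axiom N).

Hypothesis b_linearl : forall v, linear (b^~ v).

(* [annihilator N / annihilator K] embeds into [Hom (K / N, J)]. *)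
Lemma step_annihilator N K : cyclic_socle_type J -> simple_or_zero_step N K ->
  simple_or_zero_step (annihilator K) (annihilator N).
Proof.
move=> cJ [NK simN]; split=> [v /asboolP Kv|v w /asboolP Nv Kv /asboolP Nw].
  by apply/asboolP => u /NK; apply: Kv.
have [u Ku buv] : exists2 u, u \in K & b u v != 0.
  apply: contrapT => nou; case/negP: Kv; apply/asboolP => u Ku.
  by apply: contrapT => /eqP buv; apply: nou; exists u.
have Nu : u \notin N by apply: contraNN buv => /Nv ->.
(* [P] is the annihilator of the class of [u] in [K / N], a maximal ideal. It kills [b u v] and
   [b u w], since [v] and [w] annihilate [N]. *)
pose P := preimage_in (linear_scaler u) (full_submodule R^o) N.
have PP (r : R) : r \in P <-> r *: u \in N.
  by split=> [/asboolP [] //|ru]; apply/asboolP; split=> //; apply/asboolP.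
have bZ (r : R) z : b (r *: u) z = r *: b u z.
  by have := b_linearl z r u 0; rewrite (linear_fun0 (b_linearl z)) !addr0.
have maxP : maximal_ideal P.
  split; first by apply/negP => /PP; rewrite scale1r; apply/negP.
  split=> [r _|r s _ /negP Pr _]; first exact/asboolP.
  have [t Nt] : exists t, s *: u - t *: (r *: u) \in N.
    by apply: simN; [exact: rpredZ|apply/negP => ru; apply/Pr/PP|exact: rpredZ].
  by exists t; apply/PP; rewrite scalerBl -scalerA.
have [r Er] : exists r, b u w = r *: b u v.
  by apply: (cJ P maxP) => // p /PP Np; rewrite -bZ ?Nv ?Nw.
(* Modulo [N] each [z] in [K] is a multiple of [u], so the relation found at [u] holds on all of
   [K]. *)
exists r; apply/asboolP => z Kz; have [s Ns] := simN u z Ku Nu Kz.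
rewrite (linear_funB (b_linear z)).
have bE y : y \in annihilator N -> b z y = s *: b u y.
  move=> /asboolP Ny; apply/eqP; rewrite -subr_eq0.
  by rewrite -(linear_funB (b_linearl y)) Ny.
rewrite !bE; try by apply/asboolP.
by rewrite Er !scalerA mulrC subrr.
Qed.

(** Each step down the chain of [N] is one step up for annihilators, ending at the annihilator of
    zero, which is [V]. With [N] all of [U], no nonzero element of [V] killed by [U], and [j] zero,
    it bounds the length of [V] by that of [U]. *)
Lemma length_le_annihilator j k N : cyclic_socle_type J -> length_le k N ->
  length_le j (annihilator N) -> length_le (k + j)%N (full_submodule V).
Proof.
move=> cJ; elim: k N j => [|k IHk] N j.
  move=> N0; apply: length_le_sub => v _; apply/asboolP => u /N0 ->.
  exact: (linear_fun0 (b_linearl v)).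
move=> [N' /(step_annihilator cJ) stepN lenN'] lenN; rewrite addSnnS.
by apply: (IHk N') => //; exists (annihilator N).
Qed.

End Annihilator.

(* Inclusion of [K] in [L] and a length of [L] at most that of [K] force
   equality; [k] only serves to make the length of [K] finite. *)
Lemma length_le_eq (R : pzRingType) (M : lmodType R) (K L : submodClosed M) k :
  length_le k K -> {subset K <= L} ->
  (forall j, length_le j K -> length_le j L) -> {subset L <= K}.
Proof.
move=> lenK KL lenKL x Lx; apply: contrapT => /negP Kx.
elim: k lenK => [|k IHk] /lenKL /(length_le_proper KL Lx Kx) [j //].
by case=> <-.
Qed.

Section DoubleAnnihilator.
Variables (R : comPzRingType) (U V J : lmodType R) (b : U -> V -> J).
Hypotheses (b_linear : forall u, linear (b u)) (b_linearl : forall v, linear (b^~ v)).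
Hypothesis b_injr : forall v, (forall u, b u v = 0) -> v = 0.

(** Taking annihilators twice turns a chain of [K] into an equally long chain of the double
    annihilator, where [b_injr] handles the zero end. As [K] is contained in its double annihilator,
    the two coincide. *)
Lemma double_annihilator k (K : submodClosed V) : cyclic_socle_type J ->
  length_le k K ->
  annihilator b_linear (annihilator (b := fun v u => b u v) b_linearl K) =i K.
Proof.
move=> cJ lenK.
have KKK : {subset K <= annihilator b_linear
    (annihilator (b := fun v u => b u v) b_linearl K)}.
  by move=> v Kv; apply/asboolP => u /asboolP; apply.
move=> v; apply/idP/idP; last exact: KKK.
apply: (length_le_eq lenK KKK) => j; elim: j {KKK lenK} K => [|j IHj] K /=.
  move=> K0 x /asboolP Kx; apply: b_injr => u; apply: Kx; apply/asboolP => y /K0 ->.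
  exact: linear_fun0.
move=> [N stepN /IHj lenN].
exists (annihilator b_linear (annihilator (b := fun v u => b u v) b_linearl N)) => //.
by apply: (step_annihilator _ b_linearl) => //; apply: (step_annihilator _ b_linear).
Qed.

End DoubleAnnihilator.

Section Cogenerator.
Variables (R : comPzRingType) (k : nat).
Hypothesis lenR : length_le k (full_submodule R^o).
Implicit Types J X : lmodType R.

(** The pairing is the scalar action of [R] on [J]; whatever [1] annihilates is zero. *)
Lemma cyclic_socle_length_le J : cyclic_socle_type J ->
  length_le k (full_submodule J).
Proof.
move=> cJ; rewrite -[k]addn0.
have lr (r : R^o) : linear (fun x : J => (r : R) *: x).
  by move=> a x y; rewrite scalerDr !scalerA mulrC.
apply: (@length_le_annihilator _ _ _ _ _ lr (fun x => linear_scaler x) _ _ _ cJ lenR).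
by move=> x /asboolP/(_ (1 : R)); rewrite scale1r; apply; apply/asboolP.
Qed.

Lemma length_le_embedding j J J' (f : J -> J') : linear f -> injective f ->
  (exists y, forall x, f x <> y) -> length_le j (full_submodule J') ->
  exists2 i, j = i.+1 & length_le i (full_submodule J).
Proof.
move=> lf injf [y fy] lenJ'.
pose im := join_image lf (zero_submodule J') (full_submodule J).
have [|||i -> lenim] := @length_le_proper _ _ j (full_submodule J') im y _ _ _ lenJ'.
- by move=> ? _; apply/asboolP.
- exact/asboolP.
- by apply/negP => /asboolP [x _ /asboolP/eqP]; rewrite subr_eq0 => /eqP/esym /fy.
exists i => //.
have len0 : length_le 0 (preimage_in lf (full_submodule J) (zero_submodule J')).
  move=> x /asboolP [_ /asboolP fx0]; apply: injf.
  by rewrite fx0 (linear_fun0 lf).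
apply: length_le_sub (eq_rect _ (fun m => length_le m _)
  (length_le_preimage_in len0 lenim) _ (addn0 i)) => x _.
apply/asboolP; split; first exact/asboolP.
by apply/asboolP; exists x; rewrite ?subrr; apply/asboolP.
Qed.

Definition cyclic_socle_maximal J : Prop :=
  forall J' (f : J -> J'), cyclic_socle_type J' -> linear f -> injective f ->
    forall y, exists x, f x = y.

(** Otherwise proper embeddings within the class could be iterated, and each raises the length,
    eventually beyond the common bound [k]. *)
Lemma exists_cyclic_socle_maximal :
  exists2 J : lmodType R, cyclic_socle_type J & cyclic_socle_maximal J.
Proof.
apply: contrapT => nomax.
have up J : cyclic_socle_type J -> exists2 J' : lmodType R, cyclic_socle_type J' &
    forall j, length_le j (full_submodule J') ->
      exists2 i, j = i.+1 & length_le i (full_submodule J).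
  move=> cJ; apply: contrapT => noJ'; apply: nomax; exists J => // J' f cJ' lf injf y.
  apply: contrapT => noy; apply: noJ'; exists J' => // j.
  by apply: (length_le_embedding lf injf); exists y => x Ex; apply: noy; exists x.
suff [J cJ []] : exists2 J : lmodType R, cyclic_socle_type J &
    ~ length_le k (full_submodule J) by apply: cyclic_socle_length_le.
elim: (k) => [|j [J cJ lenJ]]; last first.
  by have [J' cJ' lenJ'] := up J cJ; exists J' => // /lenJ' [i [<-]].
(* The zero module starts the iteration: it has no nonzero element, so it belongs to the class
   vacuously. *)
have [|J cJ lenJ] := up (submodule (zero_submodule R^o)).
  move=> P _ x y /eqP []; by apply: val_inj; have /asboolP := valP x.
by exists J => // /lenJ [].
Qed.

(** Finite length of [R] gives an ideal maximal among the proper ideals containing the annihilator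
    of [x]. *)
Lemma exists_maximal_ideal X (x : X) : x != 0 ->
  exists2 P : submodClosed R^o, maximal_ideal P & forall r : R, r *: x = 0 -> r \in P.
Proof.
move=> x0.
have [|P [P1 xP] maxP] := exists_maximal_submodule
  (N0 := preimage_in (linear_scaler x) (full_submodule R^o) (zero_submodule X))
  (P := fun P : submodClosed R^o =>
    (1 : R) \notin P /\ forall r : R, r *: x = 0 -> r \in P) lenR.
  split=> [|r rx]; last by apply/asboolP; split; apply/asboolP.
  by apply/negP => /asboolP [_ /asboolP]; rewrite scale1r; apply/eqP.
exists P => //; split=> //; split=> [r _|r s _ Pr _]; first exact/asboolP.
pose K := join_image (linear_scaler (r : R^o)) P (full_submodule R^o).
have KP y : y \in K <-> exists c : R, y - c *: r \in P.
  split=> [/asboolP [c _ ?]|[c ?]]; first by exists c.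
  by apply/asboolP; exists c => //; apply/asboolP.
have PK : {subset P <= K}.
  by move=> y Py; apply/KP; exists 0; rewrite scale0r subr0.
have [c Pc] : exists c : R, 1 - c *: r \in P.
  apply/KP; apply: contrapT => /negP K1.
  move/negP: Pr; apply; apply: (maxP K) => //.
    by split=> // t /xP /PK.
  by apply/KP; exists 1; rewrite scale1r subrr rpred0.
exists (s * c); have -> : s - (s * c) *: r = s *: (1 - c *: r : R^o).
  by rewrite scalerBr scalerA /GRing.scale /= mulr1.
exact: rpredZ.
Qed.

Section Embedding.
Variable J : lmodType R.
Hypotheses (cJ : cyclic_socle_type J) (maxJ : cyclic_socle_maximal J).

(* Otherwise [J * R / P] would be a proper extension of [J] in the class. *)
Lemma maximal_ideal_torsion (P : submodClosed R^o) : maximal_ideal P ->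
  exists2 j : J, j != 0 & forall p : R, p \in P -> p *: j = 0.
Proof.
move=> [P1 [_ simP]]; apply: contrapT => noj.
have PJ0 (j : J) : (forall p : R, p \in P -> p *: j = 0) -> j = 0.
  by move=> Pj; apply: contrapT => /eqP j0; apply: noj; exists j.
have full := in_full_submodule (M := R^o).
have inv (s : R) : s \notin P -> exists t : R, 1 - t * s \in P.
  by move=> Ps; apply: simP.
pose J' : lmodType R := (J * quotient_module P)%type.
have cJ' : cyclic_socle_type J'.
  move=> P' maxP' [x q] [y q'] xq0 P'x P'y; have [P'1 [_ simP']] := maxP'.
  have {P'x} [P'x P'q] : (forall p : R, p \in P' -> p *: x = 0) /\
      (forall p : R, p \in P' -> p *: q = 0).
    by split=> p /P'x [].
  have {P'y} [P'y P'q'] : (forall p : R, p \in P' -> p *: y = 0) /\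
      (forall p : R, p \in P' -> p *: q' = 0).
    by split=> p /P'y [].
  (* If [P'] is contained in [P] the two agree, [J] has no such torsion, and only the simple summand
     [R / P] matters. Otherwise that summand has no [P']-torsion, and the claim reduces to [J]. *)
  have [sub|nsub] := EM {subset P' <= P}.
    have PP' : {subset P <= P'}.
      move=> u Pu; apply: contrapT => /negP P'u.
      have [t /sub Pt] := simP' u 1 (full _) P'u (full _).
      have Ptu : t *: u \in P by apply: rpredZ.
      move/negP: P1; apply.
      by have := rpredD Pt Ptu; rewrite subrK.
    have x0 : x = 0 by apply: PJ0 => p /PP'; apply: P'x.
    have y0 : y = 0 by apply: PJ0 => p /PP'; apply: P'y.
    have q0 : repr q \notin P.
      apply: contraNN xq0 => /(@quotient_proj_eq0 _ R^o P).
      by rewrite quotient_projK x0 => ->.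
    have [r Pr] := simP (repr q) (repr q') (full _) q0 (full _).
    have -> : q' = r *: q.
      rewrite -[q']quotient_projK -[q in RHS]quotient_projK.
      by rewrite -linearZ; apply/(@quotient_proj_eq _ R^o P).
    by exists r; rewrite x0 y0; congr (_, _); rewrite scaler0.
  have tors (z : quotient_module P) : (forall p : R, p \in P' -> p *: z = 0) -> z = 0.
    move=> P'z; rewrite -[z]quotient_projK; apply/(@quotient_proj_eq0 _ R^o P).
    apply: contrapT => /negP Pz; apply: nsub => p P'p.
    have [t Pt] := inv _ Pz.
    have := P'z p P'p; rewrite -[z]quotient_projK -linearZ.
    move/(@quotient_proj_eq0 _ R^o P) => Ppz.
    have -> : p = p *: (1 - t * repr z : R^o) + t *: (p *: (repr z : R^o)).
      by rewrite /GRing.scale /= mulrBr mulr1 mulrCA subrK.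
    by apply: rpredD; apply: rpredZ.
  rewrite (tors q P'q) (tors q' P'q') in xq0 *.
  have [|r ->] := cJ maxP' _ P'x P'y; first by apply: contraNneq xq0 => ->.
  by exists r; congr (_, _); rewrite scaler0.
(* Maximality makes the inclusion of [J] onto, yet the class of [1] in the second summand is not
   attained. *)
have [|x y []|x [_]] := maxJ (f := fun x : J => (x, 0) : J') cJ' _ _ (0, quotient_proj P 1).
- by move=> a x y; congr (_, _); rewrite /= scaler0 addr0.
- by [].
move/esym/(@quotient_proj_eq0 _ R^o P); exact/negP.
Qed.

(* The map from [R x] to [J] sending [x] to [j] is extended to [X]: dividing
   [J * X] by a submodule [L] containing [(j, - x)], and maximal among those
   meeting [J] trivially, gives an essential extension of [J].  It has the same
   socle as [J], hence equals [J] by maximality, and so [L] is the graph of the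
   extension. *)
Lemma exists_nonzero_functional X m (x : X) : length_le m (full_submodule X) ->
  x != 0 -> exists2 f : X -> J, linear f & f x != 0.
Proof.
move=> lenX x0; have [P maxP xP] := exists_maximal_ideal x0.
have [j j0 Pj] := maximal_ideal_torsion maxP.
pose JX : lmodType R := (J * X)%type.
have linl : linear (fun y : J => (y, 0) : JX).
  by move=> a y z; congr (_, _); rewrite /= scaler0 addr0.
have linr : linear (fun y : X => (0, y) : JX).
  by move=> a y z; congr (_, _); rewrite /= scaler0 addr0.
have [n lenJX] : exists n, length_le n (full_submodule JX).
  exists (m + (k + 0))%N.
  have len0 : length_le 0 (zero_submodule JX) by move=> ? /asboolP.
  apply: length_le_sub (length_le_join_image linr
    (length_le_join_image linl len0 (cyclic_socle_length_le cJ)) lenX) => -[y z] _.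
  apply/asboolP; exists z; first exact/asboolP.
  apply/asboolP; exists y; first exact/asboolP.
  by apply/asboolP; congr (_, _); rewrite /= ?subr0 ?subrr.
have [|L [Ljx L0] maxL] := exists_maximal_submodule
  (N0 := join_image (linear_scaler ((j, - x) : JX)) (zero_submodule JX)
     (full_submodule R^o))
  (P := fun L : submodClosed JX => (j, - x) \in L /\
    forall y : J, (y, 0) \in L -> y = 0) lenJX.
  (* A multiple of [(j, - x)] of the form [(y, 0)] is [(r *: j, 0)] with [r *: x = 0]; then [r] lies
     in [P], which kills [j]. *)
  split=> [|y /asboolP [r _ /asboolP []]].
    by apply/asboolP; exists (1 : R); [|rewrite scale1r subrr]; apply/asboolP.
  move=> /eqP; rewrite subr_eq0 => /eqP -> /eqP.
  by rewrite scalerN opprK add0r => /eqP /xP /Pj.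
pose i (y : J) : quotient_module L := quotient_proj L (y, 0).
have li : linear i by move=> a y z; rewrite /i linl linearP.
have inji : injective i.
  move=> y z /(@quotient_proj_eq _ JX L) Lyz; apply/eqP; rewrite -subr_eq0; apply/eqP.
  by apply: L0; move: Lyz; congr (_ \in L); congr (_, _); rewrite /= subr0.
have i0 : i 0 = 0 by apply: linear_fun0.
have iZ (r : R) y : i (r *: y) = r *: i y.
  by have := li r y 0; rewrite i0 !addr0.
have cQ : cyclic_socle_type (quotient_module L).
  move=> P' maxP' q q' q0 P'q P'q'; have [P'1 [_ simP']] := maxP'.
  (* The socle of the quotient comes from [J]: if [z] is nonzero, enlarging [L] by [z] must create a
     nonzero intersection with [J], so some [r *: z] is a nonzero [i y], and [r] is invertible
     modulo [P']. *)
  have ess z : (forall p : R, p \in P' -> p *: z = 0) -> exists y, z = i y.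
    move=> P'z; have [Lz|/negP Lz] := EM (repr z \in L).
      by exists 0; rewrite i0 -[z]quotient_projK; apply/(@quotient_proj_eq0 _ JX L).
    pose L' := join_image (linear_scaler (repr z : JX)) L (full_submodule R^o).
    have LL' : {subset L <= L'}.
      move=> y Ly; apply/asboolP; exists (0 : R); first exact/asboolP.
      by rewrite scale0r subr0.
    have [y [L'y y0]] : exists y : J, (y, 0) \in L' /\ y <> 0.
      apply: contrapT => noy; move/negP: Lz; apply; apply: (maxL L') => //.
        split; first exact: LL'.
        by move=> y Ly; apply: contrapT => y0; apply: noy; exists y.
      apply/asboolP; exists (1 : R); first exact/asboolP.
      by rewrite scale1r subrr rpred0.
    have /asboolP [r _ /(@quotient_proj_eq _ JX L)] := L'y.
    rewrite linearZZ /= quotient_projK -/(i y) => iy.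
    have P'r : (r : R) \notin P'.
      apply/negP => /P'z rz; apply: y0; apply: inji.
      by rewrite i0 iy rz.
    have [s P's] := simP' r 1 (in_full_submodule _) P'r (in_full_submodule _).
    exists (s *: y); rewrite iZ iy scalerA.
    by apply/eqP; rewrite -subr_eq0 -{1}[z]scale1r -scalerBl P'z.
  have [y Ey] := ess q P'q; have [z Ez] := ess q' P'q'.
  have [r Er] : exists r, z = r *: y.
    apply: (cJ maxP').
    - by apply: contraNneq q0 => y0; rewrite Ey y0 i0.
    - by move=> p P'p; apply: inji; rewrite iZ -Ey P'q ?i0.
    - by move=> p P'p; apply: inji; rewrite iZ -Ez P'q' ?i0.
  by exists r; rewrite Ey Ez Er iZ.
(* The sign matches that of [(j, - x)], so that the map with graph [L] sends [x] to [j]. *)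
have ontoL z : exists y : J, (y, - z) \in L.
  have [y /(@quotient_proj_eq _ JX L) Lyz] := maxJ cQ li inji (quotient_proj L (0, z)).
  by exists y; move: Lyz; congr (_ \in L); congr (_, _); rewrite /= ?subr0 ?sub0r.
have [f fL] := choice ontoL.
have uniq y y' z : (y, z) \in L -> (y', z) \in L -> y = y'.
  move=> Ly Ly'; apply/eqP; rewrite -subr_eq0; apply/eqP; apply: L0.
  by have := submodB Ly Ly'; congr (_ \in L); congr (_, _); rewrite /= subrr.
exists f; last by rewrite (uniq _ _ _ (fL x) Ljx).
move=> a y z; apply: (uniq _ _ _ (fL _)).
have Lay : a *: (f y, - y) \in L by apply: rpredZ; apply: fL.
have := rpredD Lay (fL z); congr (_ \in L); congr (_, _).
by rewrite /= opprD scalerN.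
Qed.

End Embedding.
End Cogenerator.

(** * The dual of a module *)

Section Hom.
Variables (R : comPzRingType) (X J : lmodType R).

Fact hom_axiom : submodule_axiom (fun f : X -> J => linear f).
Proof.
split=> [a x y|a f g lf lg b x y]; first by rewrite /= scaler0 addr0.
by rewrite !fctE lf lg !scalerDr !scalerA [RHS]addrACA [b * a]mulrC.
Qed.

Definition hom := submodule (mk_submodule hom_axiom).

HB.instance Definition _ := GRing.Lmodule.on hom.

Definition hom_fun (f : hom) : X -> J := val f.

Lemma hom_funP (f : hom) : linear (hom_fun f).
Proof. exact/asboolP/(valP f). Qed.

Definition Hom_of (f : X -> J) (lf : linear f) : hom :=
  Sub f (introT (asboolP (linear f)) lf).

Lemma hom_funE (f : X -> J) (lf : linear f) : hom_fun (Hom_of lf) = f.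
Proof. by []. Qed.

Lemma hom_eq (f g : hom) : hom_fun f =1 hom_fun g -> f = g.
Proof. by move=> fg; apply/val_inj/funext. Qed.

Lemma hom_fun_linear x : linear (hom_fun^~ x).
Proof. by []. Qed.

(* A copy of [hom] without its canonical [R]-module structure, which would
   prevent [HB.pack] from giving it a module structure over another ring. *)
Definition hom_group : Type := hom.

HB.instance Definition _ := GRing.Zmodule.on hom_group.

End Hom.

(** * Restriction of scalars along [phi] *)

Definition restrict_scalars (R : comPzRingType) (A : pzRingType)
  (phi : {rmorphism R -> A}) (M : lmodType A) : Type := M.

Section RestrictScalars.
Variables (R : comPzRingType) (A : pzRingType) (phi : {rmorphism R -> A}).
Variable M : lmodType A.
Local Notation restrict_scalars := (restrict_scalars phi M).

HB.instance Definition _ := GRing.Zmodule.on restrict_scalars.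

Definition restrict_scale (r : R) (x : restrict_scalars) : restrict_scalars :=
  phi r *: (x : M).

Fact restrict_scaleA a b x :
  restrict_scale a (restrict_scale b x) = restrict_scale (a * b) x.
Proof. by rewrite /restrict_scale scalerA rmorphM. Qed.

Fact restrict_scale1 : left_id 1 restrict_scale.
Proof. by move=> x; rewrite /restrict_scale rmorph1 scale1r. Qed.

Fact restrict_scaleDr : right_distributive restrict_scale +%R.
Proof. by move=> a x y; apply: scalerDr. Qed.

Fact restrict_scaleDl x : {morph restrict_scale^~ x : a b / a + b}.
Proof. by move=> a b; rewrite /restrict_scale rmorphD scalerDl. Qed.

HB.instance Definition _ := GRing.Zmodule_isLmodule.Build R restrict_scalars
  restrict_scaleA restrict_scale1 restrict_scaleDr restrict_scaleDl.

Lemma restrict_scaleE (r : R) (x : restrict_scalars) : r *: x = phi r *: (x : M).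
Proof. by []. Qed.

Fact restrict_scalars_axiom (N : submodClosed M) :
  submodule_axiom (fun x : restrict_scalars => (x : M) \in N).
Proof.
by split=> [|a x y Nx Ny]; rewrite ?rpred0 // rpredD ?restrict_scaleE ?rpredZ.
Qed.

Lemma restrict_scalars_finitely_generated :
  (exists (k : nat) (g : 'I_k -> A),
     forall x, exists c : 'I_k -> R, x = \sum_i phi (c i) * g i) ->
  finitely_generated M -> finitely_generated restrict_scalars.
Proof.
move=> [l [h hA]] [k [g gM]].
exists #|{: 'I_k * 'I_l}|, (fun t => h (enum_val t).2 *: g (enum_val t).1) => x.
have [a ->] := gM x; have [c cE] := choice (fun i => hA (a i)).
exists (fun t => c (enum_val t).1 (enum_val t).2).
pose F t : restrict_scalars := c t.1 t.2 *: (h t.2 *: g t.1 : restrict_scalars).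
transitivity (\sum_i \sum_j F (i, j)); last first.
  rewrite (pair_bigA _ (fun i j => F (i, j))) -(big_enum_val F).
  by apply: eq_bigr => -[].
apply: eq_bigr => i _; rewrite {1}cE scaler_suml; apply: eq_bigr => j _.
by rewrite /F restrict_scaleE scalerA.
Qed.

End RestrictScalars.

(** * The dual [Hom_R(M, J)] and its annihilator duality with [M] *)

Section DualModule.
Variables (R : comPzRingType) (A B : pzRingType) (phi : {rmorphism R -> A}).
Hypothesis phi_central : forall r x, phi r * x = x * phi r.
Variable iota : B -> A.
Hypothesis iotaD : {morph iota : b c / b + c}.
Hypothesis iotaM : forall b c, iota (b * c) = iota c * iota b.
Hypothesis iota1 : iota 1 = 1.
Hypothesis iota_surj : forall a, exists b, iota b = a.
Variables (M : lmodType A) (J : lmodType R).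
Notation MR := (restrict_scalars phi M).
Notation D := (hom_group MR J).

Fact dual_scale_linear (b : B) (f : D) :
  linear (fun x : MR => hom_fun f (iota b *: (x : M))).
Proof.
move=> r x y; rewrite -(hom_funP f) restrict_scaleE scalerDr scalerA.
by rewrite -phi_central -scalerA.
Qed.

Definition dual_scale (b : B) (f : D) : D := Hom_of (dual_scale_linear b f).

Lemma dual_scaleE b f x : hom_fun (dual_scale b f) x = hom_fun f (iota b *: (x : M)).
Proof. by []. Qed.

Fact dual_scaleA a b f : dual_scale a (dual_scale b f) = dual_scale (a * b) f.
Proof. by apply: hom_eq => x; rewrite !dual_scaleE scalerA -iotaM. Qed.

Fact dual_scale1 : left_id 1 dual_scale.
Proof. by move=> f; apply: hom_eq => x; rewrite dual_scaleE iota1 scale1r. Qed.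

Fact dual_scaleDr : right_distributive dual_scale +%R.
Proof. by move=> a f g; apply: hom_eq. Qed.

Fact dual_scaleDl f : {morph dual_scale^~ f : a b / a + b}.
Proof.
move=> a b; apply: hom_eq => x; rewrite dual_scaleE iotaD scalerDl.
have := hom_funP f 1 (iota a *: (x : M)) (iota b *: (x : M)).
by rewrite !scale1r.
Qed.

Definition dual_module : lmodType B :=
  HB.pack D (GRing.Zmodule_isLmodule.Build B D
    dual_scaleA dual_scale1 dual_scaleDr dual_scaleDl).

Notation DM := dual_module.

Lemma dual_moduleE b (f : DM) x :
  hom_fun (b *: f : DM) x = hom_fun (f : D) (iota b *: (x : M)).
Proof. by []. Qed.

Fact dual_annihilator_axiom (N : submodClosed M) :
  submodule_axiom (fun f : DM => forall x : M, x \in N -> hom_fun (f : D) x = 0).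
Proof.
split=> [//|b f g Nf Ng x Nx].
have -> : hom_fun (b *: f + g : DM) x = hom_fun (f : D) (iota b *: x) + hom_fun (g : D) x.
  by [].
by rewrite Nf ?Ng ?addr0 // rpredZ.
Qed.

Definition dual_annihilator N := mk_submodule (dual_annihilator_axiom N).

Fact predual_annihilator_axiom (K : submodClosed DM) :
  submodule_axiom (fun x : M => forall f : DM, f \in K -> hom_fun (f : D) x = 0).
Proof.
split=> [f _|a x y Kx Ky f Kf]; first exact: (linear_fun0 (hom_funP (f : D))).
(* The scalar moves to the functional: [f] at [iota b *: x] is [b *: f] at [x], and [K] is stable
   under [b]. *)
have [b <-] := iota_surj a.
have := hom_funP (f : D) 1 (iota b *: x) y; rewrite !scale1r => ->.
by rewrite -(dual_moduleE b f x) Ky ?Kx ?addr0 // rpredZ.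
Qed.

Definition predual_annihilator K := mk_submodule (predual_annihilator_axiom K).

(** On functionals [r] acts as any [b] with [iota b = phi r]. Submodules over [B] are therefore
    [R]-submodules, to which the length bounds over [R] apply. *)
Fact dual_restrict_axiom (K : submodClosed DM) :
  submodule_axiom (fun f : hom MR J => (f : DM) \in K).
Proof.
split=> [|r f g Kf Kg]; first exact: (rpred0 K).
have [b Eb] := iota_surj (phi r).
have -> : r *: f + g = (b *: (f : DM) + (g : DM) : DM).
  congr (_ + _); apply: hom_eq => x; rewrite dual_moduleE Eb.
  have := hom_funP f r x 0.
  by rewrite (linear_fun0 (hom_funP f)) !addr0 => ->.
by rewrite rpredD ?rpredZ.
Qed.

Variable k : nat.
Hypothesis lenR : length_le k (full_submodule R^o).
Hypotheses (cJ : cyclic_socle_type J) (maxJ : cyclic_socle_maximal J).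
Hypothesis A_fg : exists (l : nat) (h : 'I_l -> A),
  forall a, exists c : 'I_l -> R, a = \sum_i phi (c i) * h i.
Hypothesis M_fg : finitely_generated M.

Lemma restrict_scalars_length_le : exists m, length_le m (full_submodule MR).
Proof.
apply: (finitely_generated_length_le lenR).
exact: restrict_scalars_finitely_generated.
Qed.

Lemma hom_length_le : exists m, length_le m (full_submodule (hom MR J)).
Proof.
have [m lenM] := restrict_scalars_length_le; exists (m + 0)%N.
apply: (@length_le_annihilator _ _ _ _ (fun x f => hom_fun f x)
  (@hom_fun_linear _ _ _) (@hom_funP _ _ _) _ _ _ cJ lenM) => f /asboolP f0.
by apply: hom_eq => x; apply: f0; apply/asboolP.
Qed.

Lemma dual_module_finitely_generated : finitely_generated DM.
Proof.
have [m /length_le_finitely_generated [n [g gD]]] := hom_length_le.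
exists n, (fun i => g i : DM) => f.
have [c Ef] := gD f (in_full_submodule _).
have [psi psiE] := choice (fun r => iota_surj (phi r)).
exists (fun i => psi (c i)); rewrite [LHS]Ef.
apply: (@eq_bigr DM) => i _; apply: hom_eq => x.
rewrite dual_moduleE psiE; have := hom_funP (g i) (c i) x 0.
by rewrite (linear_fun0 (hom_funP (g i))) !addr0 => ->.
Qed.

(** A point outside [N] is detected by a functional on the quotient by [N], since [J] cogenerates
    modules of finite length. On the dual side the double annihilator is computed over [R] for the
    evaluation pairing. *)
Lemma dual_module_duality : lattice_duality dual_annihilator predual_annihilator.
Proof.
have [m lenM] := restrict_scalars_length_le.
split=> [N K NK f /asboolP Kf|K L KL x /asboolP Lx|N x|K f].
- by apply/asboolP => x /NK; apply: Kf.
- by apply/asboolP => f /KL; apply: Lx.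
- apply/idP/idP => [/asboolP NNx|Nx]; last by apply/asboolP => f /asboolP; apply.
  pose NR := mk_submodule (restrict_scalars_axiom phi N).
  apply: contrapT => Nx.
  have x0 : quotient_proj NR x != 0.
    apply/eqP => /(@quotient_proj_eq0 _ MR NR) /asboolP; exact: Nx.
  have linpi : linear (quotient_proj NR) by apply: quotient_proj_is_linear.
  have len0 : length_le 0 (zero_submodule (quotient_module NR)) by move=> ? /asboolP.
  have lenQ : length_le (m + 0)%N (full_submodule (quotient_module NR)).
    apply: length_le_sub (length_le_join_image linpi len0 lenM) => q _.
    apply/asboolP; exists (repr q); first exact/asboolP.
    by apply/asboolP; rewrite quotient_projK subrr.
  have [g lg /eqP []] := exists_nonzero_functional lenR cJ maxJ lenQ x0.
  have lgpi : linear (fun y : MR => g (quotient_proj NR y)).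
    by move=> a y z; rewrite linpi lg.
  rewrite -[g _]/(hom_fun (Hom_of lgpi) x); apply: NNx; apply/asboolP => y Ny.
  rewrite /= hom_funE.
  have -> : quotient_proj NR y = 0 by apply/(@quotient_proj_eq0 _ MR NR)/asboolP.
  exact: linear_fun0.
- have [n lenD] := hom_length_le.
  pose KR := mk_submodule (dual_restrict_axiom K).
  have lenK : length_le n KR by apply: length_le_sub lenD => ? _; apply/asboolP.
  have inj (g : hom MR J) : (forall x, hom_fun g x = 0) -> g = 0.
    by move=> g0; apply: hom_eq.
  have KKf := double_annihilator (b := fun x f => hom_fun f x)
    (@hom_fun_linear _ _ _) (@hom_funP _ _ _) inj cJ lenK f.
  have -> : (f \in K) = ((f : hom MR J) \in KR).
    by apply/idP/idP => [Kf|/asboolP //]; apply/asboolP.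
  rewrite -KKf; apply/idP/idP => /asboolP Kf; apply/asboolP => x /asboolP Kx.
    by apply: Kf; apply/asboolP => g Kg; apply: Kx; apply/asboolP.
  by apply: Kf; apply/asboolP => g /asboolP Kg; apply: Kx.
Qed.

End DualModule.

(** The anti-homomorphism [iota] is kept abstract so that one construction serves from [A] to [A^c]
    and from [A^c] to [A]; both times it is the identity map. *)
Lemma exists_dual_module (R : comPzRingType) (A B : pzRingType)
    (phi : {rmorphism R -> A}) (iota : B -> A) :
  artin_algebra phi -> {morph iota : b c / b + c} ->
  (forall b c, iota (b * c) = iota c * iota b) -> iota 1 = 1 ->
  (forall a, exists b, iota b = a) ->
  forall M : lmodType A, finitely_generated M ->
  exists2 M' : lmodType B, finitely_generated M' & lattice_dual M M'.
Proof.
move=> [artR phiC A_fg] iotaD iotaM iota1 iota_surj M M_fg.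
have [k lenR] := artinian_length_le artR.
have [J cJ maxJ] := exists_cyclic_socle_maximal lenR.
exists (dual_module phiC iotaD iotaM iota1 M J).
  exact: (dual_module_finitely_generated _ _ _ _ iota_surj lenR cJ A_fg M_fg).
do 2!eexists.
exact: (dual_module_duality phiC iotaD iotaM iota1 iota_surj lenR cJ maxJ A_fg M_fg).
Qed.

(** * The opposite algebra and the equivalence *)

Section Converse.
Variables (R : comPzRingType) (A : pzRingType) (phi : {rmorphism R -> A}).
Hypothesis hA : artin_algebra phi.

Lemma converse_monoid_morphism : monoid_morphism (phi : R -> A^c).
Proof. by split=> [|r s]; [exact: (rmorph1 phi)|rewrite mulrC; exact: (rmorphM phi)]. Qed.

Definition converse_morphism : {rmorphism R -> A^c} :=
  HB.pack (phi : R -> A^c)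
    (GRing.isZmodMorphism.Build R A^c (phi : R -> A^c) (raddfB phi))
    (GRing.isMonoidMorphism.Build R A^c (phi : R -> A^c) converse_monoid_morphism).

Lemma artin_algebra_converse : artin_algebra converse_morphism.
Proof.
have [artR phiC [l [h hP]]] := hA; split=> // [r x|].
  exact: esym (phiC r x).
exists l, h => x; have [c ->] := hP x; exists c.
by apply: eq_bigr => i _; apply: phiC.
Qed.

End Converse.

Theorem theorem4p4 (R : comPzRingType) (A : pzRingType)
    (phi : {rmorphism R -> A}) (hA : artin_algebra phi)
    (n : nat) (hn : (0 < n)%N) :
  left_Nakayama n A <-> right_coNakayama n A.
Proof.
have dualL (M : lmodType A) : finitely_generated M ->
    exists2 M' : lmodType A^c, finitely_generated M' & lattice_dual M M'.
  exact: (exists_dual_module (A := A) (B := A^c) (iota := id) hA (fun _ _ => erefl)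
    (fun _ _ => erefl) erefl (fun a => ex_intro _ a erefl)).
have dualR (M' : lmodType A^c) : finitely_generated M' ->
    exists2 M : lmodType A, finitely_generated M & lattice_dual M M'.
  move=> M'_fg.
  have [M M_fg /lattice_dual_sym MM'] := exists_dual_module (A := A^c) (B := A) (iota := id)
    (artin_algebra_converse hA) (fun _ _ => erefl) (fun _ _ => erefl) erefl
    (fun a => ex_intro _ a erefl) M'_fg.
  by exists M.
(* A property of all modules is checked on a dual over the other ring, and an existing module is
   replaced by its dual. *)
split=> [[serial [M [M_fg M_ind M_n]]]|[serial [M' [M'_fg M'_ind M'_n]]]]; split.
- move=> M' /dualR [N N_fg NM'] /(lattice_dual_indecomposable NM') /(serial N N_fg).
  by case=> i ni /(lattice_dual_serial i NM'); exists i.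
- have [M' M'_fg MM'] := dualL M M_fg; exists M'; split=> //.
    exact/(lattice_dual_indecomposable MM').
  exact/(lattice_dual_serial n MM').
- move=> M /dualL [N N_fg MN] /(lattice_dual_indecomposable MN) /(serial N N_fg).
  by case=> i ni /(lattice_dual_serial i MN); exists i.
- have [M M_fg MM'] := dualR M' M'_fg; exists M; split=> //.
    exact/(lattice_dual_indecomposable MM').
  exact/(lattice_dual_serial n MM').
Qed.
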